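(* Let $\sigma\ge 0$, and let $V$ be a complex-valued potential on the half-line with $\int_0^\infty|V(x)|\,dx<\infty$ (more generally, a finite complex Borel measure on $[0,\infty)$, with $\int_0^\infty|V(x)|\,dx$ denoting its total variation). Then any eigenvalue $\lambda\in\mathbb{C}\setminus[0,\infty)$ of the operator $-\partial^2-V$ in $L^2(0,\infty)$ with boundary conditions $\psi'(0)=\sigma\psi(0)$ satisfies $$|\lambda|^{1/2}\le\int_0^\infty|V(x)|\,dx .$$ The bound is sharp for any $\sigma\ge0$ and any fixed argument $0<\theta<2\pi$ of the eigenvalue $\lambda$; that is, for every $\sigma\ge 0$, every $\theta\in(0,2\pi)$ and every constant $\kappa<1$ there exist such a $V$ and an eigenvalue $\lambda=|\lambda|e^{i\theta}\in\mathbb{C}\setminus[0,\infty)$ of the corresponding operator with $|\lambda|^{1/2}>\kappa\int_0^\infty|V(x)|\,dx$.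
   Context: Potentials are complex-valued and may be finite complex Borel measures $V$ on $[0,\infty)$ (a point mass at $0$ is allowed); an integrable function $V$ is identified with the measure $V(x)\,dx$. The expression $\int_0^\infty|V(x)|\,dx$ denotes the $L^1$-norm of $V$, respectively the total variation of the measure $V$ on $[0,\infty)$. The operator $-\partial^2-V$ in $L^2(0,\infty)$ with boundary conditions $\psi'(0)=\sigma\psi(0)$ is defined in the quadratic form sense: it is the m-sectorial operator associated with the form $\psi\mapsto\int_0^\infty|\psi'(x)|^2\,dx+\sigma|\psi(0)|^2-\int_{[0,\infty)}|\psi|^2\,dV$ with form domain $H^1(0,\infty)$ (elements of which are identified with their continuous representatives on $[0,\infty)$). *)

(* Defs.v *)
From HB Require Import structures.
From mathcomp Require Import all_boot all_order all_algebra.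
From mathcomp Require Import complex.
From mathcomp Require Import all_classical all_reals all_analysis.
From mathcomp Require Import measurable_realfun.

Set Implicit Arguments.
Unset Strict Implicit.
Unset Printing Implicit Defensive.

Import Order.TTheory GRing.Theory Num.Theory.
Import numFieldNormedType.Exports.

Local Open Scope classical_set_scope.
Local Open Scope ring_scope.
Local Open Scope complex_scope.

Section Complex.
Context {R : realType}.

(* The norm of [R[i]] takes its (real) values in [R[i]]. *)
Definition cabs (z : R[i]) : R := complex.Re `|z|.

Definition cis (theta : R) : R[i] := cos theta +i* sin theta.

Definition off_halfline (z : R[i]) : Prop :=
  forall r : R, 0 <= r -> z <> r%:C.

End Complex.

Section Lebesgue.
Context (R : realType).
Implicit Types (D : set R) (f g u v : R -> R[i]).

Local Notation mu := (@lebesgue_measure R).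

Definition halfline : set R := `[0, +oo[.

Definition cmeasurable D f : Prop :=
  measurable_fun D (@complex.Re R \o f) /\
  measurable_fun D (@complex.Im R \o f).

Definition cint D f : R[i] :=
  (\int[mu]_(x in D) complex.Re (f x)) +i* (\int[mu]_(x in D) complex.Im (f x)).

Definition L1norm f : \bar R := (\int[mu]_(x in halfline) (cabs (f x))%:E)%E.

Definition in_L1 f : Prop :=
  cmeasurable halfline f /\ (L1norm f < +oo)%E.

Definition in_L2 f : Prop :=
  cmeasurable halfline f /\
  (\int[mu]_(x in halfline) (cabs (f x) ^+ 2)%:E < +oo)%E.

Definition eq_L2 f g : Prop := {ae mu, forall x, halfline x -> f x = g x}.

Definition inner f g : R[i] := cint halfline (fun x => f x * conjc (g x)).

(* H^1(0,oo) as the L^2 functions that are locally absolutely continuous on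
   [0,oo) with L^2 derivative; [H1_val] is the continuous representative and
   [H1_der] a representative of the derivative (unique almost everywhere). *)
Record H1 := MkH1 {
  H1_val :> R -> R[i];
  H1_der : R -> R[i];
  H1_val_L2 : in_L2 H1_val;
  H1_der_L2 : in_L2 H1_der;
  H1_FTC : forall x, 0 <= x -> H1_val x = H1_val 0 + cint `[0, x] H1_der }.

(* The graph of the operator [A] attached to a form [a] with form domain
   [H^1(0,oo)] by the first representation theorem: [A u = w] iff [u] is in
   the form domain and [a u phi = <w, phi>] for all [phi] in it.  [u] and [w]
   are representatives of elements of [L^2(0,oo)]. *)
Definition form_operator (a : H1 -> H1 -> R[i]) (u w : R -> R[i]) : Prop :=
  [/\ in_L2 u, in_L2 w &
      exists psi : H1, eq_L2 u psi /\
        forall phi : H1, a psi phi = inner w phi].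

Definition op_eigenvalue (A : (R -> R[i]) -> (R -> R[i]) -> Prop)
    (lambda : R[i]) : Prop :=
  exists u, ~ eq_L2 u (fun=> 0) /\ A u (fun x => lambda * u x).

End Lebesgue.
Arguments halfline : clear implicits.

Section Measure.
Context (R : realType).
Local Notation mu := (@lebesgue_measure R).
Local Notation borelR := (measurableTypeR R).

(* A charge of the library is finite valued, so this is a finite complex Borel
   measure on the line.  Only its restriction to [0,oo) is ever used, and every
   finite complex Borel measure on [0,oo) is such a restriction. *)
Record cmeasure := MkCMeasure {
  reM : {charge set borelR -> \bar R};
  imM : {charge set borelR -> \bar R} }.

Definition cmeas (V : cmeasure) (A : set R) : R[i] :=
  fine (reM V A) +i* fine (imM V A).

Definition cmeas_variation (V : cmeasure) (D : set R) : \bar R :=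
  ereal_sup [set s | exists (n : nat) (A : 'I_n -> set R),
    [/\ forall i, measurable (A i),
        trivIset setT A,
        \bigcup_i A i = D &
        s = (\sum_(i < n) cabs (cmeas V (A i)))%:E]].

Definition hahn_pos (nu : {charge set borelR -> \bar R}) : set borelR :=
  sval (cid (Hahn_decomposition nu)).
Definition hahn_neg (nu : {charge set borelR -> \bar R}) : set borelR :=
  sval (cid (svalP (cid (Hahn_decomposition nu)))).

Lemma hahnP (nu : {charge set borelR -> \bar R}) :
  hahn_decomposition nu (hahn_pos nu) (hahn_neg nu).
Proof. exact: svalP (cid (svalP (cid (Hahn_decomposition nu)))). Qed.

(* The value does not depend on the chosen Hahn decomposition. *)
Definition charge_int (nu : {charge set borelR -> \bar R}) (D : set R)
    (f : R -> R) : R :=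
  \int[jordan_pos (hahnP nu)]_(x in D) f x
  - \int[jordan_neg (hahnP nu)]_(x in D) f x.

Definition cmeas_int (V : cmeasure) (D : set R) (f : R -> R[i]) : R[i] :=
  let re_f := @complex.Re R \o f in
  let im_f := @complex.Im R \o f in
  (charge_int (reM V) D re_f - charge_int (imM V) D im_f) +i*
  (charge_int (reM V) D im_f + charge_int (imM V) D re_f).

End Measure.

Section Density.
Context (R : realType) (f : R -> R[i]) (f_L1 : in_L1 f).
Local Notation mu := (@lebesgue_measure R).

(* The density is cut off to [0,oo) because [induced_charge] integrates over
   subsets of the whole line. *)
Definition re_density : R -> \bar R :=
  (EFin \o (@complex.Re R \o f)) \_ (halfline R).
Definition im_density : R -> \bar R :=
  (EFin \o (@complex.Im R \o f)) \_ (halfline R).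

Lemma part_integrable (h : R[i] -> R) :
  (forall z, `|h z| <= cabs z) -> measurable_fun (halfline R) (h \o f) ->
  mu.-integrable setT ((EFin \o (h \o f)) \_ (halfline R)).
Proof.
move=> hle mh.
have mH : measurable (halfline R) by exact: measurable_itv.
apply: (@integrable_mkcond _ (measurableTypeR R) _ mu _ _ mH).1.
apply/integrableP; split; first exact/measurable_EFinP.
case: f_L1 => [[mRe mIm]]; apply: le_lt_trans.
apply: ge0_le_integral => //=.
- by apply/measurable_EFinP; apply: measurableT_comp.
- apply/measurable_EFinP.
  rewrite (_ : (fun x => _) = fun x => Num.sqrt
    ((@complex.Re R \o f) x ^+ 2 + (@complex.Im R \o f) x ^+ 2)); last first.
    by apply/funext => x; rewrite /cabs normc_def.
  apply: (@measurableT_comp _ _ _ (measurableTypeR R) R R Num.sqrt).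
    apply: continuous_measurable_fun; exact: sqrt_continuous.
  by apply: measurable_funD; apply: measurable_funX.
- by move=> x _; rewrite lee_fin.
Qed.

Lemma re_density_integrable : mu.-integrable setT re_density.
Proof.
case: (f_L1) => -[mRe _] _; apply: part_integrable => // z.
by rewrite -lecR; have := normc_ge_Re z; rewrite /cabs normc_def.
Qed.

Lemma im_density_integrable : mu.-integrable setT im_density.
Proof.
case: (f_L1) => -[_ mIm] _; apply: part_integrable => // -[a b].
rewrite /cabs normc_def /= -sqrtr_sqr ler_wsqrtr //.
by rewrite lerDr sqr_ge0.
Qed.

(* The measure [f dx] on [0,oo). *)
Definition density_measure : cmeasure R :=
  MkCMeasure (induced_charge re_density_integrable)
             (induced_charge im_density_integrable).

End Density.

Section Schrodinger.
Context (R : realType).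

(* The sesquilinear form, linear in [psi] and antilinear in [phi], whose
   diagonal is the quadratic form
   int |psi'|^2 + sigma |psi(0)|^2 - int_[0,oo) |psi|^2 dV. *)
Definition schrodinger_form (sigma : R) (V : cmeasure R)
    (psi phi : H1 R) : R[i] :=
  inner (H1_der psi) (H1_der phi) + sigma%:C * (psi 0 * conjc (phi 0))
  - cmeas_int V (halfline R) (fun x => psi x * conjc (phi x)).

Definition schrodinger_operator (sigma : R) (V : cmeasure R) :=
  form_operator (schrodinger_form sigma V).

End Schrodinger.

(* Main.v *)
(* Write lambda = - m^2 with Re m > 0.  The Green function of - d^2/dx^2 + m^2
   on the half-line with u'(0) = sigma u(0) is
     G(x, y) = (exp (- m |x - y|) + r exp (- m (x + y))) / (2 m),
     r = (m - sigma) / (m + sigma),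
   and |r| <= 1 gives |G| <= 1 / |m|.  Testing the eigenvalue equation against
   the conjugate of G(x, .) yields psi(x) = int G(x, y) psi(y) dV(y), whence
   sup |psi| <= sup |psi| |V| / |m|, i.e. |m| <= |V|.  For sharpness, the point
   mass (m + sigma) delta_0 has the eigenfunction exp (- m x), and
   |m| / |m + sigma| tends to 1 as |m| grows along a fixed argument. *)
Require Import Defs.
From HB Require Import structures.
From mathcomp Require Import all_boot all_order all_algebra.
From mathcomp Require Import complex.
From mathcomp Require Import all_classical all_reals all_analysis.
From mathcomp Require Import measurable_realfun.
From mathcomp Require Import ring lra.

Set Implicit Arguments.
Unset Strict Implicit.
Unset Printing Implicit Defensive.

Import Order.TTheory GRing.Theory Num.Theory.
Import numFieldNormedType.Exports.

Local Open Scope classical_set_scope.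
Local Open Scope ring_scope.
Local Open Scope complex_scope.

(** * Real integrals and integration by parts *)

(** The constant 1 is what costs work. The integral against V is assembled from the Jordan parts of
    Re V and Im V, and estimating these parts separately would lose a factor; so |int f dV| <= sup
    |f| |V| goes through partitions on which f is nearly constant, where the sums compare directly
    with those that define the total variation. The function G(x, .) has a kink at x and is
    therefore glued from two exponential branches: continuity at x makes it a Sobolev function, the
    unit jump of its derivative returns psi(x), and the Robin condition at 0 cancels the boundary
    term of the form. The conjugate enters because the form is antilinear in the test function. An
    element of H^1 is only a primitive of a square integrable function, so integration by parts
    against exponentials is proved from increments. An elementary Sobolev embedding makes sup |psi|
    finite; it is also positive, since an eigenfunction is not a.e. zero, and so it can be
    cancelled. *)

Lemma integrable_cst_lty (d : measure_display) (T : measurableType d)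
    (R : realType) (m : {measure set T -> \bar R}) (D : set T) (c : R) :
  measurable D -> (m D < +oo)%E -> m.-integrable D (EFin \o (fun=> c)).
Proof.
move=> mD mDy; apply/integrableP; split; first exact: measurable_cst.
under eq_integral do rewrite /=.
by rewrite integral_cst// lte_mul_pinfty.
Qed.

Section RealIntegrable.
Context (d : measure_display) (T : measurableType d) (R : realType).
Context (m : {measure set T -> \bar R}) (D : set T) (mD : measurable D).

Lemma integrable_addr (f g : T -> R) :
  m.-integrable D (EFin \o f) -> m.-integrable D (EFin \o g) ->
  m.-integrable D (EFin \o (fun x => f x + g x)).
Proof. by move=> fi gi; have := integrableD mD fi gi. Qed.

Lemma integrable_subr (f g : T -> R) :
  m.-integrable D (EFin \o f) -> m.-integrable D (EFin \o g) ->
  m.-integrable D (EFin \o (fun x => f x - g x)).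
Proof. by move=> fi gi; have := integrableB mD fi gi. Qed.

Lemma integrable_mulrl (c : R) (f : T -> R) :
  m.-integrable D (EFin \o f) -> m.-integrable D (EFin \o (fun x => c * f x)).
Proof. by move=> fi; have := integrableZl mD c fi. Qed.

Lemma integrable_mulrr (c : R) (f : T -> R) :
  m.-integrable D (EFin \o f) -> m.-integrable D (EFin \o (fun x => f x * c)).
Proof. by move=> fi; have := integrableZr mD c fi. Qed.

End RealIntegrable.

Section RealIntegrals.
Context {R : realType}.
Notation mu := (@lebesgue_measure R).

Lemma Rintegral_itv_cst (a b c : R) : a <= b ->
  \int[mu]_(x in `[a, b]) c = c * (b - a).
Proof.
move=> ab; rewrite (Rintegral_cst mu)//=; congr (_ * _).
rewrite lebesgue_measure_itv/= lte_fin.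
by case: ltgtP ab => //= -> _; rewrite subrr.
Qed.

Lemma Rintegral_itv_split (a b c : R) (f : R -> R) : a <= b -> b <= c ->
  mu.-integrable `[a, c] (EFin \o f) ->
  \int[mu]_(x in `[a, c]) f x
  = \int[mu]_(x in `[a, b]) f x + \int[mu]_(x in `[b, c]) f x.
Proof.
move=> ab bc fi.
have := @Rintegral_itvB R f (BLeft a) (BRight c) b fi.
rewrite !bnd_simp => /(_ ab bc) H.
apply/eqP; rewrite addrC -subr_eq H; apply/eqP.
apply: Rintegral_itv_obnd_cbnd; apply: integrableS fi => //.
by apply: subset_itvScc; rewrite !bnd_simp.
Qed.

Lemma Rintegral_itvy_split (a b : R) (f : R -> R) : a <= b ->
  mu.-integrable `[a, +oo[ (EFin \o f) ->
  \int[mu]_(x in `[a, +oo[) f x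
  = \int[mu]_(x in `[a, b]) f x + \int[mu]_(x in `[b, +oo[) f x.
Proof.
move=> ab fi.
have := @Rintegral_itvB R f (BLeft a) +oo%O b fi.
rewrite !bnd_simp => /(_ ab isT) H.
apply/eqP; rewrite addrC -subr_eq H; apply/eqP.
apply: Rintegral_itv_obnd_cbnd; apply: integrableS fi => //.
by move=> x /=; rewrite !in_itv/= !andbT => /ltW; exact: le_trans.
Qed.

(* Cutting [a, b] into n equal parts bounds the increment of F by
   C (b - a) (Phi b - Phi a) / n. *)
Lemma eq_of_increment_le (F Phi : R -> R) (C a b : R) :
  a <= b ->
  (forall x y, a <= x -> x <= y -> y <= b ->
     `|F y - F x| <= C * (y - x) * (Phi y - Phi x)) ->
  F b = F a.
Proof.
move=> ab H.
have key (n : nat) : `|F b - F a| <= C * (b - a) / n.+1%:R * (Phi b - Phi a).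
  pose x (k : nat) := a + (b - a) * (k%:R / n.+1%:R).
  have x0 : x 0%N = a by rewrite /x mul0r mulr0 addr0.
  have xn : x n.+1 = b by rewrite /x divff ?pnatr_eq0// mulr1 addrC subrK.
  have ba : 0 <= b - a by rewrite subr_ge0.
  have xS k : x k.+1 - x k = (b - a) / n.+1%:R.
    by rewrite /x -natr1; field; rewrite addrC natr1 pnatr_eq0.
  have xle k : x k <= x k.+1.
    by rewrite -subr_ge0 xS divr_ge0// ler0n.
  have xa k : a <= x k.
    by rewrite /x lerDl mulr_ge0// divr_ge0// ler0n.
  have xb k : (k <= n.+1)%N -> x k <= b.
    move=> kn; rewrite /x -lerBrDl ler_piMr// ler_pdivrMr ?ltr0Sn//.
    by rewrite mul1r ler_nat.
  have FE f : f b - f a = \sum_(0 <= k < n.+1) (f (x k.+1) - f (x k)) :> R.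
    by rewrite (telescope_sumr (fun k => f (x k)))// x0 xn.
  rewrite (FE F) (FE Phi) mulr_sumr; apply: le_trans (ler_norm_sum _ _ _) _.
  rewrite !big_nat; apply: ler_sum => k /andP[_ kn].
  by rewrite -[C * _ / _]mulrA -(xS k) H ?xa ?xb.
apply/eqP; rewrite -subr_eq0 -normr_le0 leNgt; apply/negP => e0.
set K := C * (b - a) * (Phi b - Phi a).
(* This [N] makes |K| / (N + 1) smaller than |F b - F a|, against [key N]. *)
pose N := Num.truncn (`|K| / `|F b - F a|).
have KN : `|K| < N.+1%:R * `|F b - F a|.
  by rewrite -ltr_pdivrMr// /N truncnS_gt.
have := key N.
rewrite mulrAC -/K ler_pdivlMr ?ltr0Sn// mulrC => /le_lt_trans.
by move=> /(_ _ (le_lt_trans (ler_norm K) KN)); rewrite ltxx.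
Qed.

(** The defect F(x) = u h - int_a^x (du h + u dh) is constant: u varies by at most the increment of
    [Phi], the primitive of |du|, and h is L-Lipschitz, so each increment of F is at most a product
    of these two first-order quantities, and [eq_of_increment_le] applies. *)
Lemma Rintegral_by_parts_primitive (a b : R) (u du h dh : R -> R) (L : R) : a <= b ->
  mu.-integrable `[a, b] (EFin \o du) ->
  (forall x, a <= x <= b -> u x = u a + \int[mu]_(t in `[a, x]) du t) ->
  mu.-integrable `[a, b] (EFin \o dh) ->
  (forall x, a <= x <= b -> h x = h a + \int[mu]_(t in `[a, x]) dh t) ->
  (forall x, a <= x <= b -> `|dh x| <= L) ->
  mu.-integrable `[a, b] (EFin \o (fun x => du x * h x)) ->
  mu.-integrable `[a, b] (EFin \o (fun x => u x * dh x)) ->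
  \int[mu]_(x in `[a, b]) (du x * h x + u x * dh x) = u b * h b - u a * h a.
Proof.
move=> ab idu uE idh hE dhL iduh iudh.
have iS (f : R -> R) x y : mu.-integrable `[a, b] (EFin \o f) ->
    a <= x -> y <= b -> mu.-integrable `[x, y] (EFin \o f).
  move=> fi ax yb; apply: integrableS fi => //.
  by apply: subset_itvScc; rewrite !bnd_simp.
have inc (f df : R -> R) x y : mu.-integrable `[a, b] (EFin \o df) ->
    (forall x, a <= x <= b -> f x = f a + \int[mu]_(t in `[a, x]) df t) ->
    a <= x -> x <= y -> y <= b -> f y - f x = \int[mu]_(t in `[x, y]) df t.
  move=> idf fE ax xy yb.
  rewrite fE ?yb ?(le_trans ax)// [f x]fE ?ax ?(le_trans xy)//.
  rewrite (@Rintegral_itv_split a x y)//; [ring|exact: iS].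
pose Phi x := \int[mu]_(t in `[a, x]) `|du t|.
have indu : mu.-integrable `[a, b] (EFin \o (fun t => `|du t|)).
  exact: integrable_norm idu.
have PhiB x y : a <= x -> x <= y -> y <= b ->
    Phi y - Phi x = \int[mu]_(t in `[x, y]) `|du t|.
  move=> ax xy yb; rewrite /Phi (@Rintegral_itv_split a x y)//; [ring|exact: iS].
have cst x y c : mu.-integrable `[x, y] (EFin \o (fun _ : R => c)).
  apply: integrable_cst_lty => //=.
  by rewrite lebesgue_measure_itv/=; case: ifP => // _; rewrite -EFinB ltry.
have hL x y : a <= x -> x <= y -> y <= b -> `|h y - h x| <= L * (y - x).
  move=> ax xy yb; rewrite (inc h dh)//.
  apply: le_trans (le_normr_Rintegral _ _) _ => //; first exact: iS.
  rewrite -Rintegral_itv_cst//.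
  apply: le_Rintegral => //; first exact/integrable_norm/iS.
  move=> t; rewrite /= in_itv/= => /andP[xt ty].
  by apply: dhL; rewrite (le_trans ax)// (le_trans ty).
have uPhi x y : a <= x -> x <= y -> y <= b -> `|u y - u x| <= Phi y - Phi x.
  move=> ax xy yb; rewrite (inc u du)// PhiB//.
  by apply: le_normr_Rintegral => //; exact: iS.
have Phi_nd x y : a <= x -> x <= y -> y <= b -> Phi x <= Phi y.
  by move=> ax xy yb; rewrite -subr_ge0 PhiB//; apply: Rintegral_ge0.
have L0 : 0 <= L by apply: le_trans (dhL a _); rewrite ?lexx.
pose g x := du x * h x + u x * dh x.
have ig : mu.-integrable `[a, b] (EFin \o g) by exact: integrable_addr.
pose F x := u x * h x - \int[mu]_(t in `[a, x]) g t.
suff : F b = F a.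
  rewrite /F set_itv1 Rintegral_set1 subr0 => <-; ring.
apply: (@eq_of_increment_le F Phi (L + L)) => // x y ax xy yb.
have -> : F y - F x = u y * h y - u x * h x - \int[mu]_(t in `[x, y]) g t.
  rewrite /F (@Rintegral_itv_split a x y)//; [ring|exact: iS].
have i1 : mu.-integrable `[x, y] (EFin \o (fun t => du t * (h y - h t))).
  rewrite (_ : _ \o _ = EFin \o (fun t => h y * du t - du t * h t)).
    apply: integrable_subr => //; last exact: iS.
    by apply: integrable_mulrl => //; exact: iS.
  by apply/funext => t /=; congr EFin; ring.
have i2 : mu.-integrable `[x, y] (EFin \o (fun t => (u x - u t) * dh t)).
  rewrite (_ : _ \o _ = EFin \o (fun t => u x * dh t - u t * dh t)).
    apply: integrable_subr => //; last exact: iS.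
    by apply: integrable_mulrl => //; exact: iS.
  by apply/funext => t /=; congr EFin; ring.
(* The splitting u y h y - u x h x = (u y - u x) h y + u x (h y - h x) leaves only differences of h
   and of u beside the derivatives. Each of the two integrals contributes one [L] to the constant L
   + L. *)
have -> : u y * h y - u x * h x - \int[mu]_(t in `[x, y]) g t =
   \int[mu]_(t in `[x, y]) (du t * (h y - h t)) +
   \int[mu]_(t in `[x, y]) ((u x - u t) * dh t).
  rewrite -RintegralD//.
  have -> : u y * h y - u x * h x
      = \int[mu]_(t in `[x, y]) (du t * h y + u x * dh t).
    rewrite RintegralD//; last 2 first.
    - by apply: integrable_mulrr => //; exact: iS.
    - by apply: integrable_mulrl => //; exact: iS.
    rewrite RintegralZr//; last exact: iS.
    rewrite RintegralZl//; last exact: iS.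
    rewrite -(inc u du)// -(inc h dh)//; ring.
  rewrite -RintegralB//.
  - by apply: eq_Rintegral => t _; rewrite /g; ring.
  - apply: integrable_addr => //.
    + by apply: integrable_mulrr => //; exact: iS.
    + by apply: integrable_mulrl => //; exact: iS.
  - exact: iS.
apply: le_trans (ler_normD _ _) _; rewrite !mulrDl; apply: lerD.
- apply: le_trans (le_normr_Rintegral _ _) _ => //.
  rewrite PhiB// -RintegralZl//; last exact: iS.
  apply: le_Rintegral => //.
  + exact: integrable_norm i1.
  + by apply: integrable_mulrl => //; exact: iS.
  + move=> t; rewrite /= in_itv/= => /andP[xt ty].
    rewrite normrM mulrC ler_wpM2r//.
    apply: le_trans (hL _ _ _ _ _) _ => //; first exact: le_trans xt.
    by rewrite ler_wpM2l// lerD2l lerN2.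
- apply: le_trans (le_normr_Rintegral _ _) _ => //.
  rewrite mulrAC -Rintegral_itv_cst//; apply: le_Rintegral => //.
  + exact: integrable_norm i2.
  + move=> t; rewrite /= in_itv/= => /andP[xt ty].
    rewrite normrM mulrC ler_pM// ?dhL ?(le_trans ax)// ?(le_trans ty)//.
    rewrite distrC; apply: le_trans (uPhi _ _ _ _ _) _ => //.
      exact: le_trans yb.
    by rewrite lerD2r Phi_nd ?(le_trans ax).
Qed.
End RealIntegrals.

(** * Integrals over half-lines as limits *)

Section HalflineLimits.
Context {R : realType}.
Notation mu := (@lebesgue_measure R).

Lemma cvg_Rintegral_itvy (c : R) (f : R -> R) :
  mu.-integrable `[c, +oo[ (EFin \o f) ->
  (fun n : nat => \int[mu]_(x in `[c, c + n%:R]) f x) @ \oo -->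
    \int[mu]_(x in `[c, +oo[) f x.
Proof.
move=> fi.
pose D := `[c, +oo[%classic : set R.
have mD : measurable D by exact: measurable_itv.
pose f_ (n : nat) := (EFin \o f) \_ `[c, c + n%:R]%classic.
have mf : measurable_fun D (EFin \o f) by exact: measurable_int fi.
have DI n : D `&` `[c, c + n%:R] = `[c, c + n%:R]%classic.
  rewrite setIC; apply/setIidPl => x; rewrite /D /= !in_itv/= andbT.
  by case/andP.
have [||||_ _] := @dominated_convergence _ _ R mu D mD f_ (EFin \o f)
  (abse \o (EFin \o f)) _ mf.
- move=> n; apply: (@measurable_restrict _ _ _ _ _ D (EFin \o f) _ mD).1.
    exact: measurable_itv.
  exact: measurable_funS mf.
- apply: aeW => x Dx; apply: cvg_near_cst.
  (* From this index on, x lies in [c, c + n], where the truncated function equals f. *)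
  exists (Num.truncn (x - c)).+1 => // n /= xn; rewrite /f_ patchE mem_set//=.
  move: Dx; rewrite /D/= !in_itv/= andbT => ->/=.
  rewrite -lerBlDl; apply: le_trans (ltW (truncnS_gt _)) _.
  by rewrite ler_nat.
- exact: integrable_abse fi.
- apply: aeW => x n Dx; rewrite /f_ patchE; case: ifP => //= _.
  by rewrite lee_fin normr0.
have /fineK <- : (\int[mu]_(x in D) (EFin \o f) x \is a fin_num)%E.
  exact: integrable_fin_num.
move=> /fine_cvgP[_].
apply: cvg_trans; apply: near_eq_cvg; near=> n => /=.
by rewrite /Rintegral /f_ -integral_mkcondr DI.
Unshelve. all: by end_near. Qed.

(** Along the points c + n the bound is a geometric sequence of ratio exp (- a) < 1. *)
Lemma cvg_expR_decay (a c M : R) (B : R -> R) : 0 < a ->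
  (forall x, c <= x -> `|B x| <= M * expR (- (a * x))) ->
  (fun n : nat => B (c + n%:R)) @ \oo --> (0 : R).
Proof.
move=> a0 BM.
have e1 : `|expR (- a)| < 1.
  by rewrite ger0_norm ?expR_ge0// -expR0 ltr_expR oppr_lt0.
have cv : (fun n : nat => (M * expR (- (a * c))) * expR (- a) ^+ n) @ \oo --> (0 : R).
  rewrite -(mulr0 (M * expR (- (a * c)))).
  by apply: cvgM; [exact: cvg_cst|exact: cvg_expr].
apply/norm_cvg0P; apply: squeeze_cvgr cv; last exact: cvg_cst.
near=> n; rewrite normr_ge0/=.
apply: le_trans (BM _ _) _; first by rewrite lerDl ler0n.
rewrite -expRM_natl -mulrA -expRD le_eqVlt; apply/orP; left; apply/eqP.
by congr (_ * expR _); ring.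
Unshelve. all: by end_near. Qed.

Lemma Rintegral_itvy_decay (a c M : R) (f B : R -> R) : 0 < a ->
  mu.-integrable `[c, +oo[ (EFin \o f) ->
  (forall x, c <= x -> \int[mu]_(t in `[c, x]) f t = B x - B c) ->
  (forall x, c <= x -> `|B x| <= M * expR (- (a * x))) ->
  \int[mu]_(x in `[c, +oo[) f x = - B c.
Proof.
move=> a0 fi fB BM; have := @cvg_Rintegral_itvy c f fi.
have : (fun n : nat => \int[mu]_(x in `[c, c + n%:R]) f x) @ \oo --> 0 - B c.
  under eq_fun do rewrite fB ?lerDl ?ler0n//.
  by apply: cvgB; [exact: cvg_expR_decay BM|exact: cvg_cst].
rewrite sub0r => h1 h2; exact: (cvg_unique _ h2 h1).
Qed.

End HalflineLimits.

(** * Complex numbers and complex-valued integrals *)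

Section ComplexNumbers.
Context {R : realType}.
Implicit Types z w : R[i].

Lemma Re_add z w : complex.Re (z + w) = complex.Re z + complex.Re w.
Proof. by case: z; case: w. Qed.

Lemma Im_add z w : complex.Im (z + w) = complex.Im z + complex.Im w.
Proof. by case: z; case: w. Qed.

Lemma Re_opp z : complex.Re (- z) = - complex.Re z.
Proof. by case: z. Qed.

Lemma Im_opp z : complex.Im (- z) = - complex.Im z.
Proof. by case: z. Qed.

Lemma Re_mul z w :
  complex.Re (z * w) = complex.Re z * complex.Re w - complex.Im z * complex.Im w.
Proof. by case: z; case: w. Qed.

Lemma Im_mul z w :
  complex.Im (z * w) = complex.Re z * complex.Im w + complex.Im z * complex.Re w.
Proof. by case: z; case: w. Qed.

Lemma Re_conjc z : complex.Re (conjc z) = complex.Re z.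
Proof. by case: z. Qed.

Lemma Im_conjc z : complex.Im (conjc z) = - complex.Im z.
Proof. by case: z. Qed.

Definition ReImE :=
  (Re_add, Im_add, Re_opp, Im_opp, Re_mul, Im_mul, Re_conjc, Im_conjc).

Lemma complex_ext z w : complex.Re z = complex.Re w ->
  complex.Im z = complex.Im w -> z = w.
Proof. by case: z; case: w => a b c d /= -> ->. Qed.

Lemma cabs_normC z : (cabs z)%:C = `|z|.
Proof. by rewrite /cabs normc_def. Qed.

Lemma cabsE z : cabs z = Num.sqrt (complex.Re z ^+ 2 + complex.Im z ^+ 2).
Proof. by rewrite /cabs normc_def. Qed.

Lemma cabs_sqr z : cabs z ^+ 2 = complex.Re z ^+ 2 + complex.Im z ^+ 2.
Proof. by rewrite cabsE sqr_sqrtr// addr_ge0 ?sqr_ge0. Qed.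

Lemma cabs_ge0 z : 0 <= cabs z.
Proof. by rewrite cabsE sqrtr_ge0. Qed.

Lemma cabs0 : cabs (0 : R[i]) = 0.
Proof. by apply: complexI; rewrite cabs_normC normr0. Qed.

Lemma cabs1 : cabs (1 : R[i]) = 1.
Proof. by apply: complexI; rewrite cabs_normC normr1. Qed.

Lemma cabsM z w : cabs (z * w) = cabs z * cabs w.
Proof. by apply: complexI; rewrite rmorphM/= !cabs_normC normrM. Qed.

Lemma cabsV z : cabs z^-1 = (cabs z)^-1.
Proof. by apply: complexI; rewrite fmorphV/= !cabs_normC normfV. Qed.

Lemma cabsN z : cabs (- z) = cabs z.
Proof. by apply: complexI; rewrite !cabs_normC normrN. Qed.

Lemma cabsD z w : cabs (z + w) <= cabs z + cabs w.
Proof. by rewrite -lecR rmorphD/= !cabs_normC ler_normD. Qed.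

Lemma cabs_eq0 z : (cabs z == 0) = (z == 0).
Proof. by rewrite -[RHS]normr_eq0 -cabs_normC -(inj_eq (@complexI R)). Qed.

Lemma cabs_gt0 z : (0 < cabs z) = (z != 0).
Proof. by rewrite lt_neqAle cabs_ge0 andbT eq_sym cabs_eq0. Qed.

Lemma cabsR (r : R) : cabs r%:C = `|r|.
Proof. by rewrite cabsE /= expr0n/= addr0 sqrtr_sqr. Qed.

Lemma Re_le_cabs z : `|complex.Re z| <= cabs z.
Proof.
rewrite cabsE -sqrtr_sqr; apply: ler_wsqrtr.
by rewrite lerDl sqr_ge0.
Qed.

Lemma Im_le_cabs z : `|complex.Im z| <= cabs z.
Proof.
rewrite cabsE -sqrtr_sqr; apply: ler_wsqrtr.
by rewrite lerDr sqr_ge0.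
Qed.

(** Too lossy for a sharp constant; it serves for boundedness and for error terms that tend to 0. *)
Lemma cabs_le_ReIm z : cabs z <= `|complex.Re z| + `|complex.Im z|.
Proof.
rewrite cabsE -[leRHS]ger0_norm ?addr_ge0// -sqrtr_sqr; apply: ler_wsqrtr.
rewrite sqrrD !real_normK ?num_real// lerD2r lerDl.
by rewrite mulrn_wge0// mulr_ge0.
Qed.

Lemma cabs_rotate z : exists2 w, cabs w = 1 & w * z = (cabs z)%:C.
Proof.
have [->|z0] := eqVneq z 0; first by exists 1; rewrite ?cabs1// mulr0 cabs0.
exists ((cabs z)%:C / z); last by rewrite divfK.
by rewrite cabsM cabsV cabsR ger0_norm ?cabs_ge0// divff// cabs_eq0.
Qed.

End ComplexNumbers.

(** * Real square integrable functions *)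

Section RealL2.
Context {R : realType}.
Notation mu := (@lebesgue_measure R).

(** Measurability of f is a separate clause because f^2 may be measurable when f is not. *)
Definition sq_integrable (D : set R) (f : R -> R) : Prop :=
  measurable_fun D f /\ mu.-integrable D (EFin \o (fun x => f x ^+ 2)).

Lemma sq_integrableS (D E : set R) (f : R -> R) : measurable D -> measurable E ->
  E `<=` D -> sq_integrable D f -> sq_integrable E f.
Proof.
move=> mD mE ED [mf fi]; split; first exact: measurable_funS mf.
exact: integrableS fi.
Qed.

(** The product is dominated by f^2 + g^2, since (f - g)^2 and (f + g)^2 are nonnegative. *)
Lemma sq_integrableM (D : set R) (f g : R -> R) : measurable D ->
  sq_integrable D f -> sq_integrable D g ->
  mu.-integrable D (EFin \o (fun x => f x * g x)).
Proof.
move=> mD [mf fi] [mg gi].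
apply: (@le_integrable _ (measurableTypeR R) R mu D mD _ _ _ _
  (@integrable_addr _ (measurableTypeR R) R mu D mD _ _ fi gi)).
  by apply/measurable_EFinP; exact: measurable_funM.
move=> x _ /=; rewrite lee_fin [leRHS]ger0_norm ?addr_ge0 ?sqr_ge0//.
rewrite ler_norml; have := sqr_ge0 (f x - g x); have := sqr_ge0 (f x + g x).
have := sqr_ge0 (f x); have := sqr_ge0 (g x).
by rewrite sqrrD sqrrB => *; apply/andP; split; lra.
Qed.

Lemma sq_integrable_bounded (D : set R) (f : R -> R) (M : R) : measurable D ->
  (mu D < +oo)%E -> measurable_fun D f -> (forall x, D x -> `|f x| <= M) ->
  sq_integrable D f.
Proof.
move=> mD Dy mf fM; split => //.
apply: (@le_integrable _ (measurableTypeR R) R mu D mD _ _ _ _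
  (@integrable_cst_lty _ (measurableTypeR R) R mu D (M ^+ 2) mD Dy)) => //.
  by apply/measurable_EFinP; exact: measurable_funX.
move=> x Dx /=; rewrite lee_fin !ger0_norm ?sqr_ge0//.
by rewrite -real_normK ?num_real// lerXn2r ?nnegrE// ?fM// (le_trans _ (fM _ Dx)).
Qed.

Lemma mu_itv_lty (a b : R) : (mu `[a, b] < +oo)%E.
Proof.
by rewrite lebesgue_measure_itv/=; case: ifP => // _; rewrite -EFinB ltry.
Qed.

Lemma sq_integrable_itv (a b : R) (f : R -> R) :
  sq_integrable `[a, b] f -> mu.-integrable `[a, b] (EFin \o f).
Proof.
move=> fi; have mI : measurable (`[a, b]%classic : set R) by exact: measurable_itv.
have c1 : sq_integrable `[a, b] (fun=> 1).
  apply: (@sq_integrable_bounded _ _ 1) => //; first exact: mu_itv_lty.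
  by move=> *; rewrite normr1.
have := sq_integrableM mI fi c1.
by under [X in EFin \o X]eq_fun do rewrite mulr1.
Qed.

End RealL2.

(** * Exponentially damped oscillations *)

Section DampedOscillation.
Context {R : realType}.
Notation mu := (@lebesgue_measure R).

(** The real face of a complex exponential: al exp ((p + i q) x) has real part of this shape with
    (A, B) = (Re al, - Im al) and imaginary part with (A, B) = (Im al, Re al). For fixed p and q the
    family is closed under differentiation. *)
Definition damped (p q A B x : R) : R :=
  expR (p * x) * (A * cos (q * x) + B * sin (q * x)).

Lemma is_derive_damped (p q A B x : R) :
  is_derive x 1 (damped p q A B) (damped p q (p * A + q * B) (p * B - q * A) x).
Proof.
have dl (c : R) : is_derive x 1 (fun y : R => c * y) c.
  have := @is_deriveZ R R^o R^o id c x 1 1 _; rewrite /GRing.scale/= mulr1.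
  by apply; exact: is_derive_id.
have de : is_derive x 1 (fun y => expR (p * y)) (expR (p * x) * p).
  exact: (@is_derive1_comp R expR _ x _ _ (is_derive_expR _) (dl p)).
have dc : is_derive x 1 (fun y => cos (q * y)) (- sin (q * x) * q).
  exact: (@is_derive1_comp R cos _ x _ _ (is_derive_cos _) (dl q)).
have ds : is_derive x 1 (fun y => sin (q * y)) (cos (q * x) * q).
  exact: (@is_derive1_comp R sin _ x _ _ (is_derive_sin _) (dl q)).
have dZ (f : R -> R) (df c : R) : is_derive x 1 f df ->
    is_derive x 1 (fun y => c * f y) (c * df).
  by move=> h; exact: (@is_deriveZ R R^o R^o f c x 1 df h).
have dD : is_derive x 1 (fun y => A * cos (q * y) + B * sin (q * y))
    (A * (- sin (q * x) * q) + B * (cos (q * x) * q)).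
  exact: is_deriveD (dZ _ _ A dc) (dZ _ _ B ds).
apply: (is_derive_eq (is_deriveM de dD)).
rewrite /damped /GRing.scale/=; ring.
Qed.

Lemma continuous_damped (p q A B : R) : continuous (damped p q A B).
Proof.
move=> x; apply/differentiable_continuous/derivable1_diffP.
by have [] := is_derive_damped p q A B x.
Qed.

Lemma measurable_damped (p q A B : R) (D : set R) : measurable D ->
  measurable_fun D (damped p q A B).
Proof.
move=> mD; apply: measurable_funTS; apply: continuous_measurable_fun.
exact: continuous_damped.
Qed.

Lemma Rintegral_damped (p q A B a b : R) : a <= b ->
  \int[mu]_(x in `[a, b]) damped p q (p * A + q * B) (p * B - q * A) x
  = damped p q A B b - damped p q A B a.
Proof.
rewrite le_eqVlt => /predU1P[->|ab]; first by rewrite set_itv1 Rintegral_set1 subrr.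
rewrite /Rintegral (@continuous_FTC2 _ _ (damped p q A B))//.
- by apply: continuous_subspaceT; exact: continuous_damped.
- split; first by move=> x _; have [] := is_derive_damped p q A B x.
  + by apply: cvg_at_right_filter; exact: continuous_damped.
  + by apply: cvg_at_left_filter; exact: continuous_damped.
- by move=> x _; rewrite derive1E; have [_ ->] := is_derive_damped p q A B x.
Qed.

Lemma integrable_expR_decay (a c : R) : 0 < a ->
  mu.-integrable `[c, +oo[ (EFin \o (fun x => expR (- (a * x)))).
Proof.
move=> a0.
have eE x : expR (- (a * x)) = damped (- a) 0 1 0 x :> R.
  by rewrite /damped !mul0r cos0 mulNr; ring.
have cE : continuous (fun x : R => expR (- (a * x))).
  by rewrite (_ : (fun x => _) = damped (- a) 0 1 0) ?funeqE//; exact: continuous_damped.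
(* The primitive that vanishes at infinity, so that the integral over the half-line is - F c. *)
pose F x := - (a^-1 * expR (- (a * x))).
have FE : F = damped (- a) 0 (- a^-1) 0.
  by apply/funext => x; rewrite /F /damped !mul0r cos0 mulNr; ring.
have dF (x : R) : is_derive x 1 F (expR (- (a * x))).
  rewrite FE eE; apply: is_derive_eq (is_derive_damped _ _ _ _ _) _.
  by rewrite !mul0r !mulr0 mulrNN divff ?gt_eqF// addr0 subr0.
apply/integrableP; split.
  apply/measurable_EFinP; apply: measurable_funTS.
  exact: continuous_measurable_fun.
under eq_integral do rewrite /= ger0_norm ?expR_ge0//.
rewrite (@ge0_continuous_FTC2y _ _ F _ 0)//.
- by rewrite -EFinB ltry.
- exact: continuous_subspaceT.
- rewrite -oppr0 -(mulr0 a^-1); apply: cvgN; apply: cvgMl_tmp.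
  apply: (@cvg_comp _ _ _ (fun x => a * x) (fun y : R => expR (- y)) _
    (pinfty_nbhs R)); last exact: cvgr_expR.
  exact: gt0_cvgMry.
- by apply: cvg_at_right_filter; rewrite FE; exact: continuous_damped.
- by move=> x _; rewrite derive1E; have [_ ->] := dF x.
Qed.

Lemma sq_integrable_decay (a c M : R) (f : R -> R) : 0 < a ->
  measurable_fun `[c, +oo[ f ->
  (forall x, c <= x -> `|f x| <= M * expR (- (a * x))) ->
  sq_integrable `[c, +oo[ f.
Proof.
move=> a0 mf fM; split => //.
have mD : measurable (`[c, +oo[%classic : set R) by exact: measurable_itv.
have a20 : 0 < a * 2 by rewrite mulr_gt0.
have := @integrable_mulrl _ (measurableTypeR R) R mu _ mD (M ^+ 2) _
  (integrable_expR_decay c a20).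
apply: le_integrable => //; first by apply/measurable_EFinP; exact: measurable_funX.
move=> x /=; rewrite in_itv/= andbT => cx.
have M0 : 0 <= M.
  by have := le_trans (normr_ge0 _) (fM _ cx); rewrite pmulr_lge0 ?expR_gt0.
rewrite lee_fin ger0_norm ?sqr_ge0// ger0_norm ?mulr_ge0 ?sqr_ge0 ?expR_ge0//.
have -> : expR (- (a * 2 * x)) = expR (- (a * x)) ^+ 2.
  by rewrite -expRM_natl; congr expR; ring.
rewrite -exprMn -[leLHS]ger0_norm ?sqr_ge0// normrX lerXn2r ?nnegrE//.
  exact: le_trans (fM _ cx).
exact: fM.
Qed.

End DampedOscillation.

(** * Complex square integrability and integration by parts *)

Section ComplexIntegrals.
Context {R : realType}.
Notation mu := (@lebesgue_measure R).
Implicit Types (D : set R) (f g : R -> R[i]).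

Definition cintegrable D f : Prop :=
  mu.-integrable D (EFin \o (@complex.Re R \o f)) /\
  mu.-integrable D (EFin \o (@complex.Im R \o f)).

Definition csq_integrable D f : Prop :=
  sq_integrable D (@complex.Re R \o f) /\ sq_integrable D (@complex.Im R \o f).

Lemma eq_cint D f g : (forall x, D x -> f x = g x) -> cint D f = cint D g.
Proof.
move=> fg; rewrite /cint; congr (_ +i* _); apply: eq_Rintegral => x;
  by rewrite inE => /fg ->.
Qed.

Lemma eq_cintegrable D f g : measurable D -> (forall x, D x -> f x = g x) ->
  cintegrable D f -> cintegrable D g.
Proof.
move=> mD fg [fr fi]; split.
- by move: fr; apply: eq_integrable => // x; rewrite inE => /fg /= ->.
- by move: fi; apply: eq_integrable => // x; rewrite inE => /fg /= ->.
Qed.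

Lemma cintegrableS D E f : measurable D -> measurable E -> E `<=` D ->
  cintegrable D f -> cintegrable E f.
Proof. by move=> mD mE ED [fr fi]; split; [exact: integrableS fr|exact: integrableS fi]. Qed.

Lemma csq_integrableS D E f : measurable D -> measurable E -> E `<=` D ->
  csq_integrable D f -> csq_integrable E f.
Proof.
by move=> mD mE ED [fr fi]; split; [exact: sq_integrableS fr|exact: sq_integrableS fi].
Qed.

Lemma cintegrableD D f g : measurable D -> cintegrable D f -> cintegrable D g ->
  cintegrable D (fun x => f x + g x).
Proof.
move=> mD [fr fi] [gr gi]; split.
- rewrite (_ : _ \o _ = fun x => complex.Re (f x) + complex.Re (g x)).
    exact: integrable_addr.
  by apply/funext => x /=; rewrite Re_add.
- rewrite (_ : _ \o _ = fun x => complex.Im (f x) + complex.Im (g x)).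
    exact: integrable_addr.
  by apply/funext => x /=; rewrite Im_add.
Qed.

Lemma cintegrableZ D (c : R[i]) f : measurable D -> cintegrable D f ->
  cintegrable D (fun x => c * f x).
Proof.
move=> mD [fr fi]; split.
- rewrite (_ : _ \o _ = fun x => complex.Re c * complex.Re (f x)
      - complex.Im c * complex.Im (f x)).
    by apply: integrable_subr => //; exact: integrable_mulrl.
  by apply/funext => x /=; rewrite Re_mul.
- rewrite (_ : _ \o _ = fun x => complex.Re c * complex.Im (f x)
      + complex.Im c * complex.Re (f x)).
    by apply: integrable_addr => //; exact: integrable_mulrl.
  by apply/funext => x /=; rewrite Im_mul.
Qed.

Lemma csq_integrableM D f g : measurable D ->
  csq_integrable D f -> csq_integrable D g -> cintegrable D (fun x => f x * g x).
Proof.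
move=> mD [fr fi] [gr gi]; split.
- rewrite (_ : _ \o _ = fun x => complex.Re (f x) * complex.Re (g x)
      - complex.Im (f x) * complex.Im (g x)).
    by apply: integrable_subr => //; exact: sq_integrableM.
  by apply/funext => x /=; rewrite Re_mul.
- rewrite (_ : _ \o _ = fun x => complex.Re (f x) * complex.Im (g x)
      + complex.Im (f x) * complex.Re (g x)).
    by apply: integrable_addr => //; exact: sq_integrableM.
  by apply/funext => x /=; rewrite Im_mul.
Qed.

Lemma cintD D f g : measurable D -> cintegrable D f -> cintegrable D g ->
  cint D (fun x => f x + g x) = cint D f + cint D g.
Proof.
move=> mD [fr fi] [gr gi]; apply: complex_ext; rewrite /= -RintegralD//;
  by apply: eq_Rintegral => x _; rewrite ?Re_add ?Im_add.
Qed.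

Lemma cintZ D (c : R[i]) f : measurable D -> cintegrable D f ->
  cint D (fun x => c * f x) = c * cint D f.
Proof.
move=> mD [fr fi]; apply: complex_ext.
- rewrite Re_mul/= -!RintegralZl// -RintegralB//; [|exact: integrable_mulrl..].
  by apply: eq_Rintegral => x _; rewrite Re_mul.
- rewrite Im_mul/= -!RintegralZl// -RintegralD//; [|exact: integrable_mulrl..].
  by apply: eq_Rintegral => x _; rewrite Im_mul.
Qed.

Lemma csq_integrableJ D f : measurable D -> csq_integrable D f ->
  csq_integrable D (fun x => conjc (f x)).
Proof.
move=> mD [fr [mfi fi]]; split.
  by rewrite (_ : _ \o _ = @complex.Re R \o f)//; apply/funext => x /=; rewrite Re_conjc.
split.
  rewrite (_ : _ \o _ = fun x => - complex.Im (f x)).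
    exact: measurableT_comp.
  by apply/funext => x /=; rewrite Im_conjc.
rewrite (_ : (fun x => _) = fun x => (@complex.Im R \o f) x ^+ 2)//.
by apply/funext => x /=; rewrite Im_conjc sqrrN.
Qed.

Lemma cint_conjc D f : measurable D -> cintegrable D f ->
  cint D (fun x => conjc (f x)) = conjc (cint D f).
Proof.
move=> mD [fr fi]; apply: complex_ext; rewrite ?Re_conjc ?Im_conjc /=.
  by apply: eq_Rintegral => x _; rewrite Re_conjc.
rewrite -mulN1r -RintegralZl//.
by apply: eq_Rintegral => x _; rewrite Im_conjc mulN1r.
Qed.

Lemma in_L2_csq_integrable f : in_L2 f -> csq_integrable (halfline R) f.
Proof.
move=> [[mr mi] fL2].
have mD : measurable (halfline R) by exact: measurable_itv.
have cf : mu.-integrable (halfline R) (EFin \o (fun x => cabs (f x) ^+ 2)).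
  apply/integrableP; split.
    apply/measurable_EFinP.
    rewrite (_ : (fun x => _) = fun x => (@complex.Re R \o f) x ^+ 2
       + (@complex.Im R \o f) x ^+ 2).
      by apply: measurable_funD; exact: measurable_funX.
    by apply/funext => x; rewrite cabs_sqr.
  by under eq_integral do rewrite /= ger0_norm ?sqr_ge0//.
split; split => //; apply: le_integrable cf => //.
- by apply/measurable_EFinP; exact: measurable_funX.
- move=> x _ /=; rewrite lee_fin !ger0_norm ?sqr_ge0// cabs_sqr lerDl sqr_ge0//.
- by apply/measurable_EFinP; exact: measurable_funX.
- move=> x _ /=; rewrite lee_fin !ger0_norm ?sqr_ge0// cabs_sqr lerDr sqr_ge0//.
Qed.

Lemma csq_integrable_in_L2 f : csq_integrable (halfline R) f -> in_L2 f.
Proof.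
have mD : measurable (halfline R) by exact: measurable_itv.
move=> [[mr fr] [mi fi]]; split => //.
have /integrableP[_] := @integrable_addr _ (measurableTypeR R) R mu _ mD _ _ fr fi.
apply: le_lt_trans; rewrite le_eqVlt; apply/orP; left; apply/eqP.
apply: eq_integral => x _ /=.
by rewrite cabs_sqr ger0_norm// addr_ge0// sqr_ge0.
Qed.

Lemma cint_itv_split (a b c : R) f : a <= b -> b <= c ->
  cintegrable `[a, c] f -> cint `[a, c] f = cint `[a, b] f + cint `[b, c] f.
Proof.
by move=> ab bc [fr fi]; apply: complex_ext; rewrite /= -Rintegral_itv_split.
Qed.

Lemma cint_itvy_split (a b : R) f : a <= b -> cintegrable `[a, +oo[ f ->
  cint `[a, +oo[ f = cint `[a, b] f + cint `[b, +oo[ f.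
Proof.
by move=> ab [fr fi]; apply: complex_ext; rewrite /= -Rintegral_itvy_split.
Qed.

Lemma cintegrable_itv (a b : R) f :
  csq_integrable `[a, b] f -> cintegrable `[a, b] f.
Proof. by move=> [fr fi]; split; exact: sq_integrable_itv. Qed.

(* The representative of u is absolutely continuous, but its derivative du is
   merely square integrable, so the library's integration by parts does not
   apply. *)
Lemma cint_by_parts (a b : R) (u du h dh : R -> R[i]) (L : R) : a <= b ->
  csq_integrable `[a, b] u -> csq_integrable `[a, b] du ->
  csq_integrable `[a, b] h -> csq_integrable `[a, b] dh ->
  (forall x, a <= x <= b -> u x = u a + cint `[a, x] du) ->
  (forall x, a <= x <= b -> h x = h a + cint `[a, x] dh) ->
  (forall x, a <= x <= b -> cabs (dh x) <= L) ->
  cint `[a, b] (fun x => du x * h x + u x * dh x) = u b * h b - u a * h a.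
Proof.
move=> ab [uR uI] [duR duI] [hR hI] [dhR dhI] uE hE dhL.
have mI : measurable (`[a, b]%classic : set R) by exact: measurable_itv.
have I := sq_integrable_itv.
(* [p] and [q] select the real or imaginary part of u and of h; the four choices give the four real
   products inside u h. The premise on [q] hands the bound [L] on |dh| down to the selected part. *)
have ibp (p q : R[i] -> R) :
    (forall z, `|q z| <= cabs z) ->
    sq_integrable `[a, b] (p \o u) -> sq_integrable `[a, b] (p \o du) ->
    sq_integrable `[a, b] (q \o h) -> sq_integrable `[a, b] (q \o dh) ->
    (forall x, a <= x <= b -> p (u x) = p (u a) + \int[mu]_(t in `[a, x]) p (du t)) ->
    (forall x, a <= x <= b -> q (h x) = q (h a) + \int[mu]_(t in `[a, x]) q (dh t)) ->
    mu.-integrable `[a, b] (EFin \o (fun x => p (du x) * q (h x) + p (u x) * q (dh x))) /\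
    \int[mu]_(x in `[a, b]) (p (du x) * q (h x) + p (u x) * q (dh x)) =
      p (u b) * q (h b) - p (u a) * q (h a).
  move=> qc pu pdu qh qdh puE qhE; split.
    apply: integrable_addr => //.
      exact: (@sq_integrableM _ _ (p \o du) (q \o h)).
    exact: (@sq_integrableM _ _ (p \o u) (q \o dh)).
  apply: (@Rintegral_by_parts_primitive _ _ _ (p \o u) (p \o du) (q \o h) (q \o dh) L) => //.
  - exact: I.
  - exact: I.
  - by move=> x axb; apply: le_trans (qc _) (dhL _ axb).
  - exact: (@sq_integrableM _ _ (p \o du) (q \o h)).
  - exact: (@sq_integrableM _ _ (p \o u) (q \o dh)).
have uRE x (axb : a <= x <= b) := congr1 (@complex.Re R) (uE x axb).
have uIE x (axb : a <= x <= b) := congr1 (@complex.Im R) (uE x axb).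
have hRE x (axb : a <= x <= b) := congr1 (@complex.Re R) (hE x axb).
have hIE x (axb : a <= x <= b) := congr1 (@complex.Im R) (hE x axb).
have {uRE}uRE x (axb : a <= x <= b) := etrans (uRE x axb) (Re_add _ _).
have {uIE}uIE x (axb : a <= x <= b) := etrans (uIE x axb) (Im_add _ _).
have {hRE}hRE x (axb : a <= x <= b) := etrans (hRE x axb) (Re_add _ _).
have {hIE}hIE x (axb : a <= x <= b) := etrans (hIE x axb) (Im_add _ _).
have [irr RR] := ibp _ _ (@Re_le_cabs R) uR duR hR dhR uRE hRE.
have [iri RI] := ibp _ _ (@Im_le_cabs R) uR duR hI dhI uRE hIE.
have [iir IR] := ibp _ _ (@Re_le_cabs R) uI duI hR dhR uIE hRE.
have [iii II] := ibp _ _ (@Im_le_cabs R) uI duI hI dhI uIE hIE.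
apply: complex_ext.
- transitivity (complex.Re (u b) * complex.Re (h b) - complex.Re (u a) * complex.Re (h a)
    - (complex.Im (u b) * complex.Im (h b) - complex.Im (u a) * complex.Im (h a))).
    rewrite -RR -II -RintegralB//=.
    by apply: eq_Rintegral => x _; rewrite !ReImE; ring.
  by rewrite !ReImE; ring.
- transitivity (complex.Re (u b) * complex.Im (h b) - complex.Re (u a) * complex.Im (h a)
    + (complex.Im (u b) * complex.Re (h b) - complex.Im (u a) * complex.Re (h a))).
    rewrite -RI -IR -RintegralD//=.
    by apply: eq_Rintegral => x _; rewrite !ReImE; ring.
  by rewrite !ReImE; ring.
Qed.

Lemma cint_itvy_decay (a c M : R) (f B : R -> R[i]) : 0 < a ->
  cintegrable `[c, +oo[ f ->
  (forall x, c <= x -> cint `[c, x] f = B x - B c) ->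
  (forall x, c <= x -> cabs (B x) <= M * expR (- (a * x))) ->
  cint `[c, +oo[ f = - B c.
Proof.
move=> a0 [fr fi] fB BM; apply: complex_ext.
- rewrite Re_opp; apply: (@Rintegral_itvy_decay _ a c M _ (@complex.Re R \o B)) => //.
  + by move=> x cx; rewrite /= -Re_opp -Re_add -fB.
  + by move=> x cx; exact: le_trans (Re_le_cabs _) (BM _ cx).
- rewrite Im_opp; apply: (@Rintegral_itvy_decay _ a c M _ (@complex.Im R \o B)) => //.
  + by move=> x cx; rewrite /= -Im_opp -Im_add -fB.
  + by move=> x cx; exact: le_trans (Im_le_cabs _) (BM _ cx).
Qed.

End ComplexIntegrals.

(** * Exponentials and Sobolev functions *)

Section Exponentials.
Context {R : realType}.
Notation mu := (@lebesgue_measure R).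
Implicit Types (z w m al be : R[i]) (x y : R).

(** This is exp (z x) for a complex rate z and a real variable x. *)
Definition cexp z x : R[i] := (expR (complex.Re z * x))%:C * cis (complex.Im z * x).

Lemma cabs_cis x : cabs (cis x) = 1.
Proof. by rewrite cabsE /= cos2Dsin2 sqrtr1. Qed.

Lemma cabs_cexp z x : cabs (cexp z x) = expR (complex.Re z * x).
Proof. by rewrite cabsM cabs_cis mulr1 cabsR ger0_norm// expR_ge0. Qed.

Lemma cexp0 z : cexp z 0 = 1.
Proof. by rewrite /cexp /cis !mulr0 expR0 cos0 sin0 mul1r. Qed.

Lemma cexpD z x y : cexp z (x + y) = cexp z x * cexp z y.
Proof.
apply: complex_ext; rewrite /cexp /cis !ReImE /=
  !(mul0r, subr0, addr0) !mulrDr expRD ?cosD ?sinD; ring.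
Qed.

Lemma cexpN z x : cexp (- z) x = cexp z (- x).
Proof. by rewrite /cexp Re_opp Im_opp !mulrN !mulNr. Qed.

Lemma cexpNK z x : cexp z x * cexp (- z) x = 1.
Proof. by rewrite cexpN -cexpD subrr cexp0. Qed.

Lemma Re_cexp al z x : complex.Re (al * cexp z x) =
  damped (complex.Re z) (complex.Im z) (complex.Re al) (- complex.Im al) x.
Proof.
by rewrite /cexp /cis /damped !ReImE /= !(mul0r, subr0, addr0); ring.
Qed.

Lemma Im_cexp al z x : complex.Im (al * cexp z x) =
  damped (complex.Re z) (complex.Im z) (complex.Im al) (complex.Re al) x.
Proof.
by rewrite /cexp /cis /damped !ReImE /= !(mul0r, subr0, addr0); ring.
Qed.

(** Keeping the factor z in the integrand avoids a division, so z = 0 is covered as well. *)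
Lemma cint_cexp al z (a b : R) : a <= b ->
  cint `[a, b] (fun x => z * al * cexp z x) = al * cexp z b - al * cexp z a.
Proof.
move=> ab; apply: complex_ext.
- rewrite Re_add Re_opp !Re_cexp -Rintegral_damped// /=.
  by apply: eq_Rintegral => x _; rewrite Re_cexp !ReImE; congr damped; ring.
- rewrite Im_add Im_opp !Im_cexp -Rintegral_damped// /=.
  by apply: eq_Rintegral => x _; rewrite Im_cexp !ReImE; congr damped; ring.
Qed.

(* The solutions of y'' = m^2 y, with hypexp' m al be = hypexp m (m al) (- m be). *)
Definition hypexp m al be x : R[i] := al * cexp m x + be * cexp (- m) x.

Lemma measurable_hypexp m al be (D : set R) : measurable D ->
  cmeasurable D (hypexp m al be).
Proof.
move=> mD; split.
- rewrite (_ : _ \o _ = fun x => complex.Re (al * cexp m x) + complex.Re (be * cexp (- m) x)).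
    apply: measurable_funD.
      by under eq_fun do rewrite Re_cexp; exact: measurable_damped.
    by under eq_fun do rewrite Re_cexp; exact: measurable_damped.
  by apply/funext => x /=; rewrite Re_add.
- rewrite (_ : _ \o _ = fun x => complex.Im (al * cexp m x) + complex.Im (be * cexp (- m) x)).
    apply: measurable_funD.
      by under eq_fun do rewrite Im_cexp; exact: measurable_damped.
    by under eq_fun do rewrite Im_cexp; exact: measurable_damped.
  by apply/funext => x /=; rewrite Im_add.
Qed.

Lemma cabs_hypexp_le m al be (b x : R) : 0 < complex.Re m -> 0 <= x <= b ->
  cabs (hypexp m al be x) <= cabs al * expR (complex.Re m * b) + cabs be.
Proof.
move=> m0 /andP[x0 xb]; apply: le_trans (cabsD _ _) _.
rewrite (cabsM al) (cabsM be) !cabs_cexp; apply: lerD.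
  by rewrite ler_wpM2l ?cabs_ge0// ler_expR ler_wpM2l// ltW.
rewrite ler_piMr ?cabs_ge0// -expR0 ler_expR Re_opp mulNr oppr_le0.
by rewrite mulr_ge0// ltW.
Qed.

Lemma csq_integrable_hypexp m al be (a b : R) : 0 < complex.Re m -> 0 <= a ->
  csq_integrable `[a, b] (hypexp m al be).
Proof.
move=> m0 a0; have [mr mi] := @measurable_hypexp m al be `[a, b] (measurable_itv _).
split; apply: (@sq_integrable_bounded _ _ _ (cabs al * expR (complex.Re m * b) + cabs be)) => //.
- exact: mu_itv_lty.
- move=> x /=; rewrite in_itv/= => /andP[ax xb].
  apply: le_trans (Re_le_cabs _) (cabs_hypexp_le _ _ m0 _).
  by rewrite xb (le_trans a0).
- exact: mu_itv_lty.
- move=> x /=; rewrite in_itv/= => /andP[ax xb].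
  apply: le_trans (Im_le_cabs _) (cabs_hypexp_le _ _ m0 _).
  by rewrite xb (le_trans a0).
Qed.

Lemma cint_hypexp m al be (a b : R) : 0 < complex.Re m -> 0 <= a -> a <= b ->
  hypexp m al be b = hypexp m al be a + cint `[a, b] (hypexp m (m * al) (- m * be)).
Proof.
move=> m0 a0 ab.
have hi al' be' : cintegrable `[a, b] (hypexp m al' be').
  by apply: cintegrable_itv; exact: csq_integrable_hypexp.
have mI : measurable (`[a, b]%classic : set R) by exact: measurable_itv.
have -> : cint `[a, b] (hypexp m (m * al) (- m * be)) =
    cint `[a, b] (fun x => m * al * cexp m x)
    + cint `[a, b] (fun x => - m * be * cexp (- m) x).
  rewrite -cintD//.
    by apply: eq_cintegrable (hi (m * al) 0) => // x _; rewrite /hypexp mul0r addr0.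
  by apply: eq_cintegrable (hi 0 (- m * be)) => // x _; rewrite /hypexp mul0r add0r.
by rewrite !cint_cexp// /hypexp; ring.
Qed.

Lemma cabs_hypexp_decay m be x :
  cabs (hypexp m 0 be x) = cabs be * expR (- (complex.Re m * x)).
Proof. by rewrite /hypexp mul0r add0r cabsM cabs_cexp Re_opp mulNr. Qed.

Lemma csq_integrable_cabs_decay (f : R -> R[i]) (a c M : R) : 0 < a ->
  cmeasurable `[c, +oo[ f ->
  (forall x, c <= x -> cabs (f x) <= M * expR (- (a * x))) ->
  csq_integrable `[c, +oo[ f.
Proof.
move=> a0 [mr mi] fM; split; apply: (@sq_integrable_decay _ a _ M) => // x cx.
  exact: le_trans (Re_le_cabs _) (fM _ cx).
exact: le_trans (Im_le_cabs _) (fM _ cx).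
Qed.

Lemma csq_integrable_hypexp_decay m be (c : R) : 0 < complex.Re m ->
  csq_integrable `[c, +oo[ (hypexp m 0 be).
Proof.
move=> m0; apply: (@csq_integrable_cabs_decay _ (complex.Re m) _ (cabs be)) => //.
  by apply: measurable_hypexp; exact: measurable_itv.
by move=> x _; rewrite cabs_hypexp_decay.
Qed.

End Exponentials.

(** * Sobolev functions on the half-line *)

Section SobolevFunctions.
Context {R : realType}.
Notation mu := (@lebesgue_measure R).
Implicit Types (psi : H1 R) (m al be : R[i]).

Let sub_halfline (a b : R) : 0 <= a -> `[a, b] `<=` halfline R.
Proof.
by move=> a0 x; rewrite /halfline /= !in_itv/= andbT => /andP[+ _]; exact: le_trans.
Qed.

Let suby_halfline (a : R) : 0 <= a -> `[a, +oo[ `<=` halfline R.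
Proof.
by move=> a0 x; rewrite /halfline /= !in_itv/= !andbT; exact: le_trans.
Qed.

Lemma csq_integrable_halfline_itv (f : R -> R[i]) (a b : R) : 0 <= a ->
  csq_integrable (halfline R) f -> csq_integrable `[a, b] f.
Proof. by move=> a0; apply: csq_integrableS (sub_halfline a0); exact: measurable_itv. Qed.

Lemma csq_integrable_halfline_itvy (f : R -> R[i]) (a : R) : 0 <= a ->
  csq_integrable (halfline R) f -> csq_integrable `[a, +oo[ f.
Proof. by move=> a0; apply: csq_integrableS (suby_halfline a0); exact: measurable_itv. Qed.

Lemma H1_val_csq psi : csq_integrable (halfline R) psi.
Proof. exact: in_L2_csq_integrable (H1_val_L2 psi). Qed.

Lemma H1_der_csq psi : csq_integrable (halfline R) (H1_der psi).
Proof. exact: in_L2_csq_integrable (H1_der_L2 psi). Qed.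

Lemma H1_FTC_itv psi (a x : R) : 0 <= a -> a <= x ->
  psi x = psi a + cint `[a, x] (H1_der psi).
Proof.
move=> a0 ax; rewrite H1_FTC ?(le_trans a0)// [psi a]H1_FTC//.
rewrite (cint_itv_split a0 ax) ?addrA//.
by apply: cintegrable_itv; apply: csq_integrable_halfline_itv (H1_der_csq psi).
Qed.

Lemma H1_by_parts psi m al be (a b : R) : 0 < complex.Re m -> 0 <= a -> a <= b ->
  cint `[a, b] (fun x => H1_der psi x * hypexp m al be x
                       + psi x * hypexp m (m * al) (- m * be) x)
  = psi b * hypexp m al be b - psi a * hypexp m al be a.
Proof.
move=> m0 a0 ab.
apply: (@cint_by_parts _ _ _ _ _ _ _
  (cabs (m * al) * expR (complex.Re m * b) + cabs (- m * be))) => //.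
- exact: csq_integrable_halfline_itv (H1_val_csq psi).
- exact: csq_integrable_halfline_itv (H1_der_csq psi).
- exact: csq_integrable_hypexp.
- exact: csq_integrable_hypexp.
- by move=> x /andP[ax _]; exact: H1_FTC_itv.
- by move=> x /andP[ax _]; exact: cint_hypexp.
- by move=> x /andP[ax xb]; apply: cabs_hypexp_le => //; rewrite xb (le_trans a0).
Qed.

(** Let S and T be the integrals of u^2 and du^2. Every interval [x, x + 1] contains a point y with
    u(y)^2 <= S + 1, as otherwise integrating over it would give S + 1 <= S. From y to x the
    function changes by at most int |du| <= 1 + T. The inequality |r| <= 1 + r^2, used for u(y) and
    for du, replaces Cauchy-Schwarz. *)
Lemma sq_integrable_primitive_bounded (u du : R -> R) :
  sq_integrable (halfline R) u -> sq_integrable (halfline R) du ->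
  (forall x y, 0 <= x -> x <= y -> u y = u x + \int[mu]_(t in `[x, y]) du t) ->
  exists M, forall x, 0 <= x -> `|u x| <= M.
Proof.
move=> [mu_ iu] [mdu idu] uE.
pose S := \int[mu]_(x in halfline R) (u x ^+ 2).
pose T := \int[mu]_(x in halfline R) (du x ^+ 2).
have mH : measurable (halfline R) by exact: measurable_itv.
have iS (f : R -> R) (x y : R) : 0 <= x -> mu.-integrable (halfline R) (EFin \o f) ->
    mu.-integrable `[x, y] (EFin \o f).
  by move=> x0; apply: integrableS => //; exact: sub_halfline.
have le_half (f : R -> R) (x y : R) : (forall t, 0 <= f t) -> 0 <= x -> x <= y ->
    mu.-integrable (halfline R) (EFin \o f) ->
    \int[mu]_(t in `[x, y]) f t <= \int[mu]_(t in halfline R) f t.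
  move=> f0 x0 xy fi; rewrite (Rintegral_itvy_split x0 fi).
  have fi' : mu.-integrable `[x, +oo[ (EFin \o f).
    by apply: integrableS fi => //; exact: suby_halfline.
  rewrite (Rintegral_itvy_split xy fi') addrCA lerDl addr_ge0//; exact: Rintegral_ge0.
exists (1 + (S + 1) + (1 + T)) => x x0.
have [y /andP[xy yx1] uy] : exists2 y, x <= y <= x + 1 & u y ^+ 2 <= S + 1.
  apply: contrapT => H.
  have : S + 1 <= S.
    rewrite -[leLHS]mulr1 -[X in _ * X <= _](addrK x 1) [1 + x]addrC.
    rewrite -Rintegral_itv_cst ?lerDl//.
    apply: le_trans (le_half _ x (x + 1) _ x0 _ iu); rewrite ?lerDl//;
      last by move=> ?; exact: sqr_ge0.
    apply: le_Rintegral => //.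
    - by apply: (@integrable_cst_lty _ (measurableTypeR R)) => //; exact: mu_itv_lty.
    - exact: iS.
    - move=> t /=; rewrite in_itv/= => tx; rewrite leNgt; apply/negP => uS.
      by apply: H; exists t => //; exact: ltW.
  by rewrite gerDl ler10.
have -> : u x = u y - \int[mu]_(t in `[x, y]) du t.
  by rewrite (uE x y x0 xy) addrK.
have le1sq (r : R) : `|r| <= 1 + r ^+ 2.
  by rewrite ler_norml; have := sqr_ge0 (r - 1); have := sqr_ge0 (r + 1);
    rewrite sqrrB1 sqrrD1 => *; apply/andP; split; lra.
have idu1 : mu.-integrable `[x, y] (EFin \o du).
  apply: sq_integrable_itv; split; last exact: iS.
  by apply: measurable_funS mdu => //; exact: sub_halfline.
have ic1 : mu.-integrable `[x, y] (EFin \o (fun=> 1)).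
  by apply: (@integrable_cst_lty _ (measurableTypeR R)) => //; exact: mu_itv_lty.
apply: le_trans (ler_normB _ _) _; apply: lerD.
  by apply: le_trans (le1sq _) _; rewrite lerD2l.
apply: le_trans (le_normr_Rintegral _ _) _ => //.
apply: (@le_trans _ _ (\int[mu]_(t in `[x, y]) (1 + du t ^+ 2))).
  apply: le_Rintegral => //.
  - exact: integrable_norm idu1.
  - by apply: integrable_addr => //; exact: iS.
rewrite RintegralD//; last exact: iS.
apply: lerD.
  by rewrite Rintegral_itv_cst// mul1r lerBlDl.
by apply: le_half => // t; exact: sqr_ge0.
Qed.

(** The Sobolev embedding into bounded functions. It removes boundary terms at infinity, makes sup
    |psi| finite in the eigenvalue bound, and bounds the integrand for the point mass. *)
Lemma H1_bounded psi : exists M, forall x, 0 <= x -> cabs (psi x) <= M.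
Proof.
have [vr vi] := H1_val_csq psi; have [dr di] := H1_der_csq psi.
have [|M1 h1] := sq_integrable_primitive_bounded vr dr.
- by move=> x y x0 xy; rewrite /= (H1_FTC_itv psi x0 xy) Re_add.
have [|M2 h2] := sq_integrable_primitive_bounded vi di.
- by move=> x y x0 xy; rewrite /= (H1_FTC_itv psi x0 xy) Im_add.
exists (M1 + M2) => x x0; apply: le_trans (cabs_le_ReIm _) _.
by apply: lerD; [exact: h1|exact: h2].
Qed.

(** With the growing coefficient equal to 0, the product at infinity is a bounded function times a
    decaying exponential, so only the boundary term at c survives. *)
Lemma H1_by_parts_decay psi m be (c : R) : 0 < complex.Re m -> 0 <= c ->
  cint `[c, +oo[ (fun x => H1_der psi x * hypexp m 0 be x
                         + psi x * hypexp m 0 (- m * be) x)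
  = - (psi c * hypexp m 0 be c).
Proof.
move=> m0 c0; have [M psiM] := H1_bounded psi.
have mI : measurable (`[c, +oo[%classic : set R) by exact: measurable_itv.
apply: (@cint_itvy_decay _ (complex.Re m) c (M * cabs be) _
  (fun x => psi x * hypexp m 0 be x)) => //.
- apply: cintegrableD => //; apply: csq_integrableM => //.
  + exact: csq_integrable_halfline_itvy (H1_der_csq psi).
  + exact: csq_integrable_hypexp_decay.
  + exact: csq_integrable_halfline_itvy (H1_val_csq psi).
  + exact: csq_integrable_hypexp_decay.
- by move=> x cx; rewrite -H1_by_parts// mulr0.
- move=> x cx; rewrite cabsM cabs_hypexp_decay mulrA ler_wpM2r ?expR_ge0//.
  by rewrite ler_wpM2r ?cabs_ge0// psiM// (le_trans c0).
Qed.

End SobolevFunctions.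

(** * Integration against complex measures *)

Section FinitePartitions.
Context (d : measure_display) (T : measurableType d) (R : realType).

Lemma bigcup_ord_bigsetU (n : nat) (A : 'I_n -> set T) :
  \bigcup_i A i = \big[setU/set0]_(i < n) A i.
Proof.
rewrite -(bigcup_pred (T := 'I_n) predT A); apply: eq_bigcupl.
by split=> i _.
Qed.

Lemma Rintegral_partition (m : {measure set T -> \bar R}) (D : set T) (n : nat)
    (A : 'I_n -> set T) (f : T -> R) :
  (forall i, measurable (A i)) -> trivIset setT A -> \bigcup_i A i = D ->
  measurable D -> m.-integrable D (EFin \o f) ->
  \int[m]_(x in D) f x = \sum_(i < n) \int[m]_(x in A i) f x.
Proof.
move=> mA tA AD mD fi.
have AiD i : A i `<=` D by rewrite -AD; exact: bigcup_sup.
have fiA i : m.-integrable (A i) (EFin \o f) by exact: integrableS fi.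
rewrite bigcup_ord_bigsetU in AD.
rewrite {1}/Rintegral -{1}AD integral_bigsetU_EFin//.
- rewrite (eq_bigr (fun i => (\int[m]_(x in A i) f x)%:E)) ?sumEFin// => i _.
  by rewrite /Rintegral fineK//; exact: integrable_fin_num (fiA i).
- exact: index_enum_uniq.
- by apply: sub_trivIset tA => i _.
- by rewrite AD; exact: measurable_int fi.
Qed.

Lemma Rintegral_partition_approx (m : {finite_measure set T -> \bar R})
    (D : set T) (n : nat) (A : 'I_n -> set T) (f : T -> R) (c : 'I_n -> R) (e : R) :
  (forall i, measurable (A i)) -> trivIset setT A -> \bigcup_i A i = D ->
  measurable D -> m.-integrable D (EFin \o f) ->
  (forall i x, A i x -> `|f x - c i| <= e) ->
  `|\int[m]_(x in D) f x - \sum_(i < n) c i * fine (m (A i))| <= e * fine (m D).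
Proof.
move=> mA tA AD mD fi fc.
have AiD i : A i `<=` D by rewrite -AD; exact: bigcup_sup.
have fiA i : m.-integrable (A i) (EFin \o f) by exact: integrableS fi.
have mlty (B : set T) : measurable B -> (m B < +oo)%E.
  by move=> mB; rewrite ltey_eq fin_num_measure.
have cst (B : set T) r : measurable B -> m.-integrable B (EFin \o (fun=> r)).
  by move=> mB; apply: integrable_cst_lty => //; exact: mlty.
(* The right-hand side becomes the integral of the constant [e], cut along the same partition, and
   the pieces are compared one by one. *)
rewrite -(Rintegral_cst m mD) (Rintegral_partition mA tA AD mD fi).
rewrite (Rintegral_partition mA tA AD mD (cst D e mD)) -sumrB.
apply: le_trans (ler_norm_sum _ _ _) _; apply: ler_sum => i _.
rewrite -(Rintegral_cst m (mA i)) -RintegralB//; last exact: cst.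
apply: le_trans (le_normr_Rintegral _ _) _ => //.
  by apply: integrable_subr => //; exact: cst.
apply: le_Rintegral => //; last exact: fc.
  by apply: integrable_norm; apply: integrable_subr => //; exact: cst.
exact: cst.
Qed.

End FinitePartitions.

(** * Integrals against complex measures and total variation *)

Section ComplexMeasureIntegral.
Context {R : realType}.
Local Notation borelR := (measurableTypeR R).

(** This is |nu|(D), the total variation of a real charge; here it only scales approximation
    errors. *)
Definition charge_mass (nu : {charge set borelR -> \bar R}) (D : set borelR) : R :=
  fine (jordan_pos (hahnP nu) D) + fine (jordan_neg (hahnP nu) D).

Lemma charge_mass_ge0 nu D : 0 <= charge_mass nu D.
Proof. by apply: addr_ge0; apply: fine_ge0; exact: measure_ge0. Qed.

Lemma integrable_bounded_finite (m : {finite_measure set borelR -> \bar R})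
    (D : set borelR) (f : R -> R) (M : R) :
  measurable D -> measurable_fun D f -> (forall x, D x -> `|f x| <= M) ->
  m.-integrable D (EFin \o f).
Proof.
move=> mD mf fM.
have mDlty : (m D < +oo)%E by rewrite ltey_eq fin_num_measure.
apply: (le_integrable mD _ _ (integrable_cst_lty M mD mDlty)).
  exact/measurable_EFinP.
move=> x Dx /=; rewrite lee_fin; apply: le_trans (fM _ Dx) _; exact: ler_norm.
Qed.

Lemma charge_int_partition_approx (nu : {charge set borelR -> \bar R})
    (D : set borelR) (n : nat) (A : 'I_n -> set borelR)
    (f : R -> R) (c : 'I_n -> R) (e M : R) :
  (forall i, measurable (A i)) -> trivIset setT A -> \bigcup_i A i = D ->
  measurable D ->
  measurable_fun D f -> (forall x, D x -> `|f x| <= M) ->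
  (forall i x, A i x -> `|f x - c i| <= e) ->
  `|charge_int nu D f - \sum_(i < n) c i * fine (nu (A i))| <= e * charge_mass nu D.
Proof.
move=> mA tA AD mD mf fM fc.
have nuE i : fine (nu (A i)) =
    fine (jordan_pos (hahnP nu) (A i)) - fine (jordan_neg (hahnP nu) (A i)).
  rewrite (jordan_decomp (hahnP nu) (mA i)) /cadd/= /cscale/= EFinN mulN1e fineB//.
    exact: fin_num_measure.
  exact: fin_num_measure.
under eq_bigr do rewrite nuE mulrBr.
have h1 := Rintegral_partition_approx mA tA AD mD
  (integrable_bounded_finite (jordan_pos (hahnP nu)) mD mf fM) fc.
have h2 := Rintegral_partition_approx mA tA AD mD
  (integrable_bounded_finite (jordan_neg (hahnP nu)) mD mf fM) fc.
rewrite sumrB /charge_int /charge_mass mulrDr.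
apply: le_trans (lerD h1 h2); apply: le_trans (ler_normB _ _).
by rewrite le_eqVlt; apply/orP; left; apply/eqP; congr `|_|; ring.
Qed.

(** The pieces are the preimages of bands of height e, so the partition is adapted to g and needs no
    continuity. *)
Lemma measurable_fun_grid (D : set R) (g : R -> R) (M e : R) :
  measurable D -> measurable_fun D g -> (forall x, D x -> `|g x| <= M) -> 0 < e ->
  exists (n : nat) (A : 'I_n -> set R),
  [/\ forall i, measurable (A i), trivIset setT A, \bigcup_i A i = D &
      forall i x y, A i x -> A i y -> `|g x - g y| <= e].
Proof.
move=> mD mg gM e0.
(* The shift by [M] makes the values nonnegative and the division turns bands of height [e] into [i,
   i + 1[. Since h <= 2 M / e, the band indices run from 0 to the integer part of 2 M / e. *)
pose h x := (g x + M) / e.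
have mh : measurable_fun D h.
  by apply: measurable_funM => //; apply: measurable_funD.
pose A (i : nat) := D `&` h @^-1` `[i%:R, i.+1%:R[%classic.
have AP i x : A i x -> D x /\ (i%:R <= h x < i.+1%:R).
  by case=> Dx /=; rewrite in_itv.
exists (Num.truncn (2 * M / e)).+1, A; split.
- by move=> i; apply: mh => //; exact: measurable_itv.
- move=> i j _ _ [x [/AP[_ /andP[ix xi]] /AP[_ /andP[jx xj]]]].
  apply/val_inj/eqP; rewrite /= eqn_leq; apply/andP; split.
    by rewrite -ltnS -(ltr_nat R) (le_lt_trans ix xj).
  by rewrite -ltnS -(ltr_nat R) (le_lt_trans jx xi).
- apply/seteqP; split=> [x [i _ [//]]|x Dx].
  have := gM _ Dx; rewrite ler_norml => /andP[Mg gM'].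
  have h0 : 0 <= h x by rewrite divr_ge0 ?(ltW e0)//; lra.
  have hM : h x <= 2 * M / e by rewrite ler_pM2r ?invr_gt0//; lra.
  have tn : (Num.truncn (h x) < (Num.truncn (2 * M / e)).+1)%N.
    rewrite ltnS; exact: le_truncn.
  exists (Ordinal tn) => //; split => //=.
  by rewrite in_itv/=; exact: truncn_itv.
- move=> i x y /AP[_ /andP[ix xi]] /AP[_ /andP[iy yi]].
  have : `|h x - h y| <= 1.
    by rewrite ler_norml; rewrite -natr1 in xi yi; apply/andP; split; lra.
  have -> : h x - h y = (g x - g y) / e by rewrite /h; field; rewrite gt_eqF.
  by rewrite normrM normfV (ger0_norm (ltW e0)) ler_pdivrMr// mul1r.
Qed.

(** On a partition where Re f and Im f both oscillate by at most e, the integral is close to a sum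
    of terms f(x_k) V(A_k), whose modulus is at most M times one of the sums defining the variation.
    Only the error sees the Jordan parts, and it vanishes with e, so the constant in front of M v
    stays 1. *)
Lemma cmeas_int_le (V : cmeasure R) (f : R -> R[i]) (M v : R) :
  cmeasurable (halfline R) f -> (forall x, 0 <= x -> cabs (f x) <= M) ->
  (cmeas_variation V (halfline R) <= v%:E)%E ->
  cabs (cmeas_int V (halfline R) f) <= M * v.
Proof.
move=> [mr mi] fM Vv.
have mH : measurable (halfline R) by exact: measurable_itv.
have M0 : 0 <= M by apply: le_trans (cabs_ge0 _) (fM 0 _).
have HP (x : R) : halfline R x -> 0 <= x by rewrite /halfline/= in_itv/= andbT.
have frM x : halfline R x -> `|complex.Re (f x)| <= M.
  by move=> /HP x0; exact: le_trans (Re_le_cabs _) (fM _ x0).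
have fiM x : halfline R x -> `|complex.Im (f x)| <= M.
  by move=> /HP x0; exact: le_trans (Im_le_cabs _) (fM _ x0).
pose K := charge_mass (reM V) (halfline R) + charge_mass (imM V) (halfline R).
have K0 : 0 <= K by rewrite addr_ge0// charge_mass_ge0.
(* One error e K comes from the real part of the integral and one from the imaginary part. *)
suff H e : 0 < e -> cabs (cmeas_int V (halfline R) f) <= M * v + (e * K + e * K).
  apply/ler_addgt0Pr => e e0.
  (* The added 1 keeps the denominator positive when K = 0. *)
  apply: le_trans (H (e / (K + K + 1)) _) _; first by rewrite divr_gt0//; lra.
  rewrite lerD2l -mulrDr mulrAC ler_pdivrMr; last by lra.
  by rewrite ler_pM2l//; lra.
move=> e0.
have [n1 [A1 [mA1 tA1 A1H A1e]]] := measurable_fun_grid mH mr frM e0.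
have [n2 [A2 [mA2 tA2 A2H A2e]]] := measurable_fun_grid mH mi fiM e0.
(* The common refinement of both grids is indexed by pairs, then renumbered by ordinals to match the
   partitions in [cmeas_variation]. *)
pose I : finType := ('I_n1 * 'I_n2)%type.
pose A (k : 'I_#|I|) := A1 (enum_val k).1 `&` A2 (enum_val k).2.
have mA k : measurable (A k) by exact: measurableI.
have tA : trivIset setT A.
  move=> k l _ _ [x [[x1 x2] [y1 y2]]]; apply: enum_val_inj.
  have e1 : (enum_val k).1 = (enum_val l).1 by apply: tA1 => //; exists x.
  have e2 : (enum_val k).2 = (enum_val l).2 by apply: tA2 => //; exists x.
  by rewrite [LHS]surjective_pairing [RHS]surjective_pairing e1 e2.
have AH : \bigcup_k A k = halfline R.
  apply/seteqP; split=> [x [k _ [x1 _]]|x Hx].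
    by rewrite -A1H; exists (enum_val k).1.
  have [i _ xi] : (\bigcup_i A1 i) x by rewrite A1H.
  have [j _ xj] : (\bigcup_i A2 i) x by rewrite A2H.
  by exists (enum_rank ((i, j) : I)) => //; rewrite /A enum_rankK.
(* A sample value of f on each piece. On an empty piece the default point is 0, which lies in the
   half-line, so the bound [M] still applies. *)
pose c (k : 'I_#|I|) := f (xget 0 (A k)).
have cA k x : A k x -> A k (xget 0 (A k)) by move=> Akx; apply: xgetPex; exists x.
have cM k : cabs (c k) <= M.
  apply: fM; case: (pselect (exists x, A k x)) => [[x /cA Ax]|Ak0].
    by apply: HP; rewrite -AH; exists k.
  by rewrite xgetPN// => x Akx; apply: Ak0; exists x.
have cr k x : A k x -> `|complex.Re (f x) - complex.Re (c k)| <= e.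
  by move=> Ax; have [h1 _] := cA k x Ax; case: Ax => [x1 _]; exact: A1e x1 h1.
have ci k x : A k x -> `|complex.Im (f x) - complex.Im (c k)| <= e.
  by move=> Ax; have [_ h1] := cA k x Ax; case: Ax => [_ x1]; exact: A2e x1 h1.
pose S := \sum_k c k * cmeas V (A k).
have -> : cmeas_int V (halfline R) f = S + (cmeas_int V (halfline R) f - S).
  by rewrite addrC subrK.
apply: le_trans (cabsD _ _) _; apply: lerD.
  apply: (@le_trans _ _ (\sum_k M * cabs (cmeas V (A k)))).
    have cs (F : 'I_#|I| -> R[i]) : cabs (\sum_k F k) <= \sum_k cabs (F k).
      elim/big_ind2: _ => [|x1 x2 y1 y2 h1 h2|//]; first by rewrite cabs0.
      exact: le_trans (cabsD _ _) (lerD h1 h2).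
    apply: le_trans (cs _) _; apply: ler_sum => k _.
    by rewrite cabsM ler_wpM2r// cabs_ge0.
  rewrite -mulr_sumr ler_wpM2l// -lee_fin; apply: le_trans Vv.
  by apply: ereal_sup_ubound; exists #|I|, A; split.
have ReS : complex.Re S = \sum_k complex.Re (c k) * fine (reM V (A k))
                        - \sum_k complex.Im (c k) * fine (imM V (A k)).
  rewrite -sumrB /S (big_morph _ (@Re_add R) (erefl : complex.Re 0 = 0)).
  by apply: eq_bigr => k _; rewrite Re_mul.
have ImS : complex.Im S = \sum_k complex.Re (c k) * fine (imM V (A k))
                        + \sum_k complex.Im (c k) * fine (reM V (A k)).
  rewrite -big_split /S (big_morph _ (@Im_add R) (erefl : complex.Im 0 = 0)).
  by apply: eq_bigr => k _; rewrite Im_mul.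
have ap (nu : {charge set borelR -> \bar R}) (p : R[i] -> R) :
    measurable_fun (halfline R) (p \o f) -> (forall x, halfline R x -> `|p (f x)| <= M) ->
    (forall k x, A k x -> `|p (f x) - p (c k)| <= e) ->
  `|charge_int nu (halfline R) (p \o f) - \sum_k p (c k) * fine (nu (A k))|
     <= e * charge_mass nu (halfline R).
  move=> mp pM pc.
  exact: (@charge_int_partition_approx nu _ _ A (p \o f) (p \o c) e M).
have rr := ap (reM V) _ mr frM cr.
have ri := ap (reM V) _ mi fiM ci.
have ir := ap (imM V) _ mr frM cr.
have ii := ap (imM V) _ mi fiM ci.
apply: le_trans (cabs_le_ReIm _) _; apply: lerD.
- rewrite Re_add Re_opp ReS /= /K mulrDr.
  apply: le_trans (lerD rr ii); apply: le_trans (ler_normB _ _).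
  by rewrite le_eqVlt; apply/orP; left; apply/eqP; congr `|_|; ring.
- rewrite Im_add Im_opp ImS /= /K mulrDr.
  apply: le_trans (lerD ri ir); apply: le_trans (ler_normD _ _).
  by rewrite le_eqVlt; apply/orP; left; apply/eqP; congr `|_|; ring.
Qed.

End ComplexMeasureIntegral.

(** * Total variation of a measure with density *)

Section DensityVariation.
Context {R : realType}.
Notation mu := (@lebesgue_measure R).

Lemma measurable_cabs (D : set R) (f : R -> R[i]) : cmeasurable D f ->
  measurable_fun D (fun x => cabs (f x)).
Proof.
move=> [mr mi].
rewrite (_ : (fun x => _) = fun x => Num.sqrt
  ((@complex.Re R \o f) x ^+ 2 + (@complex.Im R \o f) x ^+ 2)); last first.
  by apply/funext => x; rewrite cabsE.
apply: (@measurableT_comp _ _ _ (measurableTypeR R) R R Num.sqrt).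
  by apply: continuous_measurable_fun; exact: sqrt_continuous.
by apply: measurable_funD; apply: measurable_funX.
Qed.

(** A unimodular factor w rotates the integral onto the nonnegative axis; there it equals the
    integral of Re (w f), which is pointwise at most |f|. *)
Lemma cabs_cint_le (D : set R) (f : R -> R[i]) : measurable D ->
  cintegrable D f -> mu.-integrable D (EFin \o (fun x => cabs (f x))) ->
  cabs (cint D f) <= \int[mu]_(x in D) cabs (f x).
Proof.
move=> mD fi cfi; have [w w1 wE] := cabs_rotate (cint D f).
have [ri _] := cintegrableZ w mD fi.
have -> : cabs (cint D f) = \int[mu]_(x in D) complex.Re (w * f x).
  by have := congr1 (@complex.Re R) wE; rewrite -cintZ//= => <-.
apply: le_Rintegral => // x _; apply: le_trans (ler_norm _) _.
by apply: le_trans (Re_le_cabs _) _; rewrite cabsM w1 mul1r.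
Qed.

(** Each piece A contributes |int_A f| <= int_A |f|, and these add up to the norm. This carries the
    bound for measures over to integrable potentials. *)
Lemma cmeas_variation_density (f : R -> R[i]) (f_L1 : in_L1 f) :
  (cmeas_variation (density_measure f_L1) (halfline R) <= L1norm f)%E.
Proof.
have mH : measurable (halfline R) by exact: measurable_itv.
have [mf fy] := f_L1.
have fi : mu.-integrable (halfline R) (EFin \o (fun x => cabs (f x))).
  apply/integrableP; split.
    by apply/measurable_EFinP; exact: measurable_cabs.
  apply: le_lt_trans fy; rewrite le_eqVlt; apply/orP; left; apply/eqP.
  by apply: eq_integral => x _ /=; rewrite ger0_norm ?cabs_ge0.
have cfi : cintegrable (halfline R) f.
  case: mf => mr mi; split; apply: le_integrable fi => //.
  - exact/measurable_EFinP.
  - by move=> x _ /=; rewrite lee_fin [leRHS]ger0_norm ?cabs_ge0// Re_le_cabs.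
  - exact/measurable_EFinP.
  - by move=> x _ /=; rewrite lee_fin [leRHS]ger0_norm ?cabs_ge0// Im_le_cabs.
apply: ge_ereal_sup => _ [n [A [mA tA AH ->]]].
have AiH i : A i `<=` halfline R by rewrite -AH; exact: bigcup_sup.
(* The cut-off of the density to the half-line disappears on pieces contained in it. *)
have cE i : cmeas (density_measure f_L1) (A i) = cint (A i) f.
  rewrite /cmeas /cint /=; congr (_ +i* _).
    rewrite /induced_charge /re_density -integral_mkcondr.
    by rewrite (setIidl (AiH i)).
  rewrite /induced_charge /im_density -integral_mkcondr.
  by rewrite (setIidl (AiH i)).
have -> : L1norm f = (\int[mu]_(x in halfline R) cabs (f x))%:E.
  by rewrite /Rintegral fineK//; exact: (integrable_fin_num _ fi).
rewrite (@Rintegral_partition _ _ _ mu _ _ A)// lee_fin.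
apply: ler_sum => i _; rewrite cE; apply: cabs_cint_le => //.
- exact: (cintegrableS mH (mA i) (AiH i) cfi).
- by apply: integrableS fi; [exact: mH|exact: mA|exact: AiH].
Qed.

End DensityVariation.

(** * Point masses *)

Section PointMass.
Context {R : realType}.
Local Notation borelR := (measurableTypeR R).

(** [charge_int] uses a chosen Hahn decomposition about which nothing explicit is known. Up to sign,
    the Jordan parts are nu restricted to the two Hahn sets, so they too vanish on D minus a, and
    each integral reduces to the single point a. *)
Lemma charge_int_supported_at (nu : {charge set borelR -> \bar R}) (a : R)
    (D : set borelR) (f : R -> R) (M : R) :
  measurable D -> D a -> measurable_fun D f -> (forall x, D x -> `|f x| <= M) ->
  (forall A, measurable A -> ~ A a -> nu A = 0%E) ->
  charge_int nu D f = f a * fine (nu [set a]).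
Proof.
move=> mD Da mf fM nu0.
have ma : measurable [set a] by exact: measurable_set1.
have mDa : measurable (D `\ a) by exact: measurableD.
have key (m : {finite_measure set borelR -> \bar R}) : m (D `\ a) = 0%E ->
    \int[m]_(x in D) f x = f a * fine (m [set a]).
  move=> m0; have fi := integrable_bounded_finite m mD mf fM.
  have m0y : (m (D `\ a) < +oo)%E by rewrite m0.
  have Da' : D = [set a] `|` D `\ a by rewrite setD1K.
  rewrite {1}Da' Rintegral_setU//; last 2 first.
  - by rewrite -Da'.
  - by apply/disj_setPS => x [-> [_ +]]; apply.
  have -> : \int[m]_(x in [set a]) f x = \int[m]_(x in [set a]) (f a).
    by apply: eq_Rintegral => x; rewrite inE => ->.
  rewrite Rintegral_cst// [X in _ + X](_ : _ = 0) ?addr0//.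
  apply/eqP; rewrite -normr_le0.
  have fi' : m.-integrable (D `\ a) (EFin \o f) by apply: integrableS fi => // x [].
  apply: le_trans (le_normr_Rintegral _ _) _ => //.
  apply: (@le_trans _ _ (\int[m]_(x in D `\ a) M)).
    apply: le_Rintegral => //; first exact: integrable_norm fi'.
      exact: integrable_cst_lty mDa m0y.
    by move=> x [Dx _]; exact: fM.
  rewrite (Rintegral_cst m mDa) [X in _ * X <= _](congr1 fine m0) mulr0//.
have [mP mN] : measurable (hahn_pos nu) /\ measurable (hahn_neg nu).
  by case: (hahnP nu) => -[? _] [? _] _ _; split.
have jp : jordan_pos (hahnP nu) (D `\ a) = 0%E.
  rewrite jordan_posE cjordan_posE /crestr0 mem_set// /crestr nu0//.
    exact: measurableI.
  by move=> [[_ +] _]; apply.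
have jn : jordan_neg (hahnP nu) (D `\ a) = 0%E.
  rewrite jordan_negE cjordan_negE /crestr0 mem_set// /crestr nu0 ?oppe0//.
    exact: measurableI.
  by move=> [[_ +] _]; apply.
rewrite /charge_int !key// -mulrBr; congr (_ * _).
rewrite [RHS](congr1 fine (jordan_decomp (hahnP nu) ma)).
rewrite /cadd/= /cscale/= EFinN mulN1e fineB//.
  exact: fin_num_measure.
exact: fin_num_measure.
Qed.

Definition point_charge (c a : R) : {charge set borelR -> \bar R} :=
  cscale c (charge_of_finite_measure (@dirac _ borelR a R)).

Definition point_mass (c : R[i]) (a : R) : cmeasure R :=
  MkCMeasure (point_charge (complex.Re c) a) (point_charge (complex.Im c) a).

Lemma point_chargeE (c a : R) (A : set borelR) :
  point_charge c a A = (c * (a \in A)%:R)%:E.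
Proof.
by rewrite /point_charge /= /cscale /charge_of_finite_measure /= diracE EFinM.
Qed.

Lemma cmeas_point_mass (c : R[i]) (a : R) (A : set R) :
  cmeas (point_mass c a) A = if a \in A then c else 0.
Proof.
rewrite /cmeas -[reM _]/(point_charge (complex.Re c) a).
rewrite -[imM _]/(point_charge (complex.Im c) a) !point_chargeE /=.
by case: (a \in A); rewrite ?mulr1 ?mulr0//; case: c.
Qed.

(** At most one piece of a partition contains a, so at most one term of each sum is nonzero. *)
Lemma cmeas_variation_point_mass (c : R[i]) (a : R) (D : set R) :
  (cmeas_variation (point_mass c a) D <= (cabs c)%:E)%E.
Proof.
apply: ge_ereal_sup => _ [n [A [mA tA AH ->]]]; rewrite lee_fin.
case: (pselect (exists i, A i a)) => [[i Aia]|Aa].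
  rewrite (bigD1 i)//= cmeas_point_mass mem_set// big1 ?addr0// => j ji.
  rewrite cmeas_point_mass memNset ?cabs0// => Aja.
  by move/eqP: ji; apply; apply: tA => //; exists a.
rewrite big1 ?cabs_ge0// => j _.
by rewrite cmeas_point_mass memNset ?cabs0// => Aja; apply: Aa; exists j.
Qed.

Lemma cmeas_int_point_mass (c : R[i]) (a : R) (D : set R) (f : R -> R[i]) (M : R) :
  measurable D -> D a -> cmeasurable D f -> (forall x, D x -> cabs (f x) <= M) ->
  cmeas_int (point_mass c a) D f = c * f a.
Proof.
move=> mD Da [mr mi] fM.
have cE (r : R) (g : R -> R) : measurable_fun D g -> (forall x, D x -> `|g x| <= M) ->
    charge_int (point_charge r a) D g = r * g a.
  move=> mg gM; rewrite (@charge_int_supported_at _ a _ _ M)//.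
    by rewrite point_chargeE mem_set//= mulr1 mulrC.
  by move=> A mA Aa; rewrite point_chargeE memNset// mulr0.
have frM x : D x -> `|(@complex.Re R \o f) x| <= M.
  by move=> Dx; exact: le_trans (Re_le_cabs _) (fM _ Dx).
have fiM x : D x -> `|(@complex.Im R \o f) x| <= M.
  by move=> Dx; exact: le_trans (Im_le_cabs _) (fM _ Dx).
apply: complex_ext; rewrite /cmeas_int !cE//= ?Re_mul ?Im_mul//.
Qed.

End PointMass.

(** * The Green function and the eigenvalue bound *)

Section GluedExponentials.
Context {R : realType}.
Notation mu := (@lebesgue_measure R).
Implicit Types (m al be ga : R[i]).

(** A glued function takes its left branch at the gluing point, so on the right it matches the other
    branch only beyond that point; a single endpoint is Lebesgue null. *)
Lemma eq_cint_obnd (a : R) (b : itv_bound R) (f g : R -> R[i]) :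
  cintegrable [set` Interval (BLeft a) b] f ->
  cintegrable [set` Interval (BLeft a) b] g ->
  (forall x, [set` Interval (BRight a) b] x -> f x = g x) ->
  cint [set` Interval (BLeft a) b] f = cint [set` Interval (BLeft a) b] g.
Proof.
move=> [fr fi] [gr gi] fg.
have sub : [set` Interval (BRight a) b] `<=` [set` Interval (BLeft a) b].
  by apply: subset_itvr; rewrite bnd_simp.
have iS (h : R -> R) : mu.-integrable [set` Interval (BLeft a) b] (EFin \o h) ->
    mu.-integrable [set` Interval (BRight a) b] (EFin \o h).
  by apply: integrableS => //; exact: measurable_itv.
apply: complex_ext => /=.
  rewrite -(Rintegral_itv_obnd_cbnd (iS _ fr)) -(Rintegral_itv_obnd_cbnd (iS _ gr)).
  by apply: eq_Rintegral => x; rewrite inE => /fg /= ->.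
rewrite -(Rintegral_itv_obnd_cbnd (iS _ fi)) -(Rintegral_itv_obnd_cbnd (iS _ gi)).
by apply: eq_Rintegral => x; rewrite inE => /fg /= ->.
Qed.

Definition glue m (x0 : R) al be ga (y : R) : R[i] :=
  if y <= x0 then hypexp m al be y else hypexp m 0 ga y.

Lemma csq_integrable_glue m (x0 : R) al be ga : 0 < complex.Re m ->
  csq_integrable (halfline R) (glue m x0 al be ga).
Proof.
move=> m0; pose a := complex.Re m.
pose C := cabs al * expR (a * x0) + cabs be.
have C0 : 0 <= C by rewrite addr_ge0 ?cabs_ge0// mulr_ge0 ?cabs_ge0 ?expR_ge0.
have mle : measurable_fun setT (fun y : R => y <= x0) by exact: measurable_fun_ler.
have mT : measurable [set: R] by [].
have [m1r m1i] := @measurable_hypexp R m al be setT mT.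
have [m2r m2i] := @measurable_hypexp R m 0 ga setT mT.
(* On [0, x0] the left branch is at most [C], and C <= C exp (a x0) exp (- a y) there; [cabs ga]
   accounts for the right branch. *)
apply: (@csq_integrable_cabs_decay _ _ a 0 (C * expR (a * x0) + cabs ga)) => //.
  split; apply: measurable_funTS.
    rewrite (_ : _ \o _ = fun y => if y <= x0
        then complex.Re (hypexp m al be y) else complex.Re (hypexp m 0 ga y)).
      exact: measurable_fun_ifT.
    by apply/funext => y /=; rewrite /glue; case: ifP.
  rewrite (_ : _ \o _ = fun y => if y <= x0
      then complex.Im (hypexp m al be y) else complex.Im (hypexp m 0 ga y)).
    exact: measurable_fun_ifT.
  by apply/funext => y /=; rewrite /glue; case: ifP.
move=> y y0; rewrite /glue mulrDl; case: ifPn => yx0.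
  apply: le_trans (cabs_hypexp_le al be m0 (b := x0) _) _; first by rewrite y0.
  rewrite -/a -/C -mulrA -expRD -[leLHS]addr0 lerD// ?mulr_ge0 ?cabs_ge0 ?expR_ge0//.
  rewrite ler_peMr// -expR0 ler_expR -mulrBr mulr_ge0 ?subr_ge0//.
  exact: ltW.
by rewrite cabs_hypexp_decay -/a -[leLHS]add0r lerD2r !mulr_ge0 ?expR_ge0.
Qed.

Lemma glue_FTC m (x0 : R) al be ga (x : R) : 0 < complex.Re m -> 0 <= x0 ->
  hypexp m al be x0 = hypexp m 0 ga x0 -> 0 <= x ->
  glue m x0 al be ga x = glue m x0 al be ga 0
    + cint `[0, x] (glue m x0 (m * al) (- m * be) (- m * ga)).
Proof.
move=> m0 x00 hx0 x_ge0.
have gi y : cintegrable `[0, y] (glue m x0 (m * al) (- m * be) (- m * ga)).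
  by apply/cintegrable_itv/csq_integrable_halfline_itv => //; exact: csq_integrable_glue.
have le_part y : 0 <= y -> y <= x0 ->
    hypexp m al be y = hypexp m al be 0
      + cint `[0, y] (glue m x0 (m * al) (- m * be) (- m * ga)).
  move=> y0 yx0; rewrite (@cint_hypexp _ m al be 0 y)//; congr (_ + _).
  apply: eq_cint => t /=; rewrite in_itv/= => /andP[_ ty].
  by rewrite /glue (le_trans ty yx0).
rewrite {2}/glue x00; have [xx0|x0x] := leP x x0.
  by rewrite {1}/glue xx0; exact: le_part.
rewrite {1}/glue leNgt x0x /= (cint_itv_split x00 (ltW x0x))// addrA -le_part// hx0.
rewrite (cint_hypexp 0 ga m0 x00 (ltW x0x)) mulr0; congr (_ + _).
apply: (@eq_cint_obnd x0 (BRight x)).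
- by apply: cintegrable_itv; exact: csq_integrable_hypexp.
- by apply/cintegrable_itv/csq_integrable_halfline_itv => //; exact: csq_integrable_glue.
- by move=> t /=; rewrite in_itv/= => /andP[x0t _]; rewrite /glue leNgt x0t.
Qed.

Definition H1_glue m (x0 : R) al be ga (m0 : 0 < complex.Re m) (x00 : 0 <= x0)
    (hx0 : hypexp m al be x0 = hypexp m 0 ga x0) : H1 R :=
  MkH1 (csq_integrable_in_L2 (csq_integrable_glue x0 al be ga m0))
       (csq_integrable_in_L2
         (csq_integrable_glue x0 (m * al) (- m * be) (- m * ga) m0))
       (fun x => @glue_FTC m x0 al be ga x m0 x00 hx0).

Lemma H1_conj_FTC (phi : H1 R) (x : R) : 0 <= x ->
  conjc (phi x) = conjc (phi 0) + cint `[0, x] (fun t => conjc (H1_der phi t)).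
Proof.
move=> x0; rewrite cint_conjc//.
  by rewrite -rmorphD/= -H1_FTC.
by apply/cintegrable_itv/csq_integrable_halfline_itv => //; exact: H1_der_csq.
Qed.

Definition H1_conj (phi : H1 R) : H1 R :=
  MkH1 (csq_integrable_in_L2 (csq_integrableJ (measurable_itv _) (H1_val_csq phi)))
       (csq_integrable_in_L2 (csq_integrableJ (measurable_itv _) (H1_der_csq phi)))
       (H1_conj_FTC phi).

(** The boundary terms from the two sides of x0 combine into psi x0 times the jump of the glued
    function. *)
Lemma H1_by_parts_glue (psi : H1 R) m (x0 : R) al be ga :
  0 < complex.Re m -> 0 <= x0 ->
  cint (halfline R) (fun x => H1_der psi x * glue m x0 al be ga x
     + psi x * glue m x0 (m * al) (- m * be) (- m * ga) x)
  = psi x0 * (hypexp m al be x0 - hypexp m 0 ga x0) - psi 0 * hypexp m al be 0.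
Proof.
move=> m0 x00.
have mH : measurable (halfline R) by exact: measurable_itv.
have fi : cintegrable (halfline R) (fun x => H1_der psi x * glue m x0 al be ga x
     + psi x * glue m x0 (m * al) (- m * be) (- m * ga) x).
  apply: cintegrableD => //; apply: csq_integrableM => //.
  - exact: H1_der_csq.
  - exact: csq_integrable_glue.
  - exact: H1_val_csq.
  - exact: csq_integrable_glue.
rewrite /halfline (cint_itvy_split x00 fi).
have -> : cint `[0, x0] (fun x => H1_der psi x * glue m x0 al be ga x
     + psi x * glue m x0 (m * al) (- m * be) (- m * ga) x)
   = psi x0 * hypexp m al be x0 - psi 0 * hypexp m al be 0.
  rewrite -H1_by_parts//; apply: eq_cint => t /=; rewrite in_itv/= => /andP[_ tx0].
  by rewrite /glue tx0.
have -> : cint `[x0, +oo[ (fun x => H1_der psi x * glue m x0 al be ga x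
     + psi x * glue m x0 (m * al) (- m * be) (- m * ga) x)
   = - (psi x0 * hypexp m 0 ga x0).
  rewrite -H1_by_parts_decay//; apply: (@eq_cint_obnd x0 +oo%O).
  - apply: (cintegrableS mH _ _ fi); first exact: measurable_itv.
    by move=> t /=; rewrite /halfline/= !in_itv/= !andbT; exact: le_trans.
  - apply: cintegrableD; [exact: measurable_itv|apply: csq_integrableM..].
    + exact: measurable_itv.
    + by apply: csq_integrable_halfline_itvy => //; exact: H1_der_csq.
    + exact: csq_integrable_hypexp_decay.
    + exact: measurable_itv.
    + by apply: csq_integrable_halfline_itvy => //; exact: H1_val_csq.
    + exact: csq_integrable_hypexp_decay.
  - by move=> t /=; rewrite in_itv/= andbT => x0t; rewrite /glue leNgt x0t.
by ring.
Qed.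

End GluedExponentials.

(** * Resolvent kernel and eigenvalue bound *)

Section Resolvent.
Context {R : realType}.
Notation mu := (@lebesgue_measure R).
Implicit Types (m al be ga : R[i]) (psi phi : H1 R).

Lemma cmeasurableM (D : set R) (f g : R -> R[i]) : cmeasurable D f ->
  cmeasurable D g -> cmeasurable D (fun x => f x * g x).
Proof.
move=> [fr fi] [gr gi]; split.
- rewrite (_ : _ \o _ = fun x => complex.Re (f x) * complex.Re (g x)
      - complex.Im (f x) * complex.Im (g x)).
    by apply: measurable_funB; exact: measurable_funM.
  by apply/funext => x /=; rewrite Re_mul.
- rewrite (_ : _ \o _ = fun x => complex.Re (f x) * complex.Im (g x)
      + complex.Im (f x) * complex.Re (g x)).
    by apply: measurable_funD; exact: measurable_funM.
  by apply/funext => x /=; rewrite Im_mul.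
Qed.

Lemma csq_integrable_cmeasurable (D : set R) (f : R -> R[i]) :
  csq_integrable D f -> cmeasurable D f.
Proof. by move=> [[mr _] [mi _]]; split. Qed.

Lemma ae_imp (P Q : R -> Prop) : (forall x, P x -> Q x) ->
  {ae mu, forall x, P x} -> {ae mu, forall x, Q x}.
Proof.
by move=> PQ; apply: filterS => //; exact: (ae_filter_ringOfSetsType mu).
Qed.

Lemma eq_L2_cint (f g : R -> R[i]) :
  cintegrable (halfline R) f -> cintegrable (halfline R) g -> eq_L2 f g ->
  cint (halfline R) f = cint (halfline R) g.
Proof.
move=> [fr fi] [gr gi] fg.
have mH : measurable (halfline R) by exact: measurable_itv.
apply: complex_ext; rewrite /= /Rintegral; congr fine; apply: ae_eq_integral => //.
- exact: measurable_int fr.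
- exact: measurable_int gr.
- by apply: ae_imp fg => x /= fgx Hx; rewrite fgx.
- exact: measurable_int fi.
- exact: measurable_int gi.
- by apply: ae_imp fg => x /= fgx Hx; rewrite fgx.
Qed.

(** Integration by parts is applied to the derivative g' of the glued function g. Since g'' = m^2 g
    on both branches, this is the weak form of - g'' + m^2 g, with the jump of g' at x0 and its
    value at 0 as the only boundary data. *)
Lemma H1_weak_glue psi m (x0 : R) al be ga : 0 < complex.Re m -> 0 <= x0 ->
  cint (halfline R)
    (fun x => H1_der psi x * glue m x0 (m * al) (- m * be) (- m * ga) x)
  + m ^+ 2 * cint (halfline R) (fun x => psi x * glue m x0 al be ga x)
  = psi x0 * (hypexp m (m * al) (- m * be) x0 - hypexp m 0 (- m * ga) x0)
    - psi 0 * hypexp m (m * al) (- m * be) 0.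
Proof.
move=> m0 x00; have mH : measurable (halfline R) by exact: measurable_itv.
have i1 : cintegrable (halfline R)
    (fun x => H1_der psi x * glue m x0 (m * al) (- m * be) (- m * ga) x).
  apply: csq_integrableM => //; first exact: H1_der_csq.
  exact: csq_integrable_glue.
have i2 : cintegrable (halfline R) (fun x => psi x * glue m x0 al be ga x).
  apply: csq_integrableM => //; first exact: H1_val_csq.
  exact: csq_integrable_glue.
rewrite -cintZ// -cintD//; last exact: cintegrableZ.
rewrite -H1_by_parts_glue//; apply: eq_cint => x _; congr (_ + _).
by rewrite /glue /hypexp; case: ifP => _; ring.
Qed.

(** The reflection coefficient: the r for which exp (m y) + r exp (- m y) satisfies the boundary
    condition, from m (1 - r) = sigma (1 + r). *)
Definition robin_coef m (sigma : R) : R[i] := (m - sigma%:C) / (m + sigma%:C).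

Lemma robin_denom_neq0 m (sigma : R) : 0 < complex.Re m -> 0 <= sigma ->
  m + sigma%:C != 0.
Proof.
move=> m0 s0; apply/eqP => /(congr1 (@complex.Re R)).
by rewrite Re_add /= => /eqP; rewrite gt_eqF// ltr_pwDl.
Qed.

(** This is |m + sigma|^2 - |m - sigma|^2 = 4 sigma Re m >= 0. *)
Lemma cabs_robin_coef_le1 m (sigma : R) : 0 < complex.Re m -> 0 <= sigma ->
  cabs (robin_coef m sigma) <= 1.
Proof.
move=> m0 s0; rewrite cabsM cabsV ler_pdivrMr ?mul1r; last first.
  by rewrite cabs_gt0 robin_denom_neq0.
rewrite -(@ler_pXn2r _ 2)// ?nnegrE ?cabs_ge0// !cabs_sqr !ReImE /=.
have := mulr_ge0 (ltW m0) s0; nra.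
Qed.

(* The coefficients of exp (m y) and exp (- m y) in G(x0, y), for y <= x0 (al
   and be) and for y > x0 (only ga, the other one being 0). *)
Definition green_al m (x0 : R) : R[i] := cexp (- m) x0 / (2 * m).
Definition green_be m (sigma x0 : R) : R[i] :=
  robin_coef m sigma * cexp (- m) x0 / (2 * m).
Definition green_ga m (sigma x0 : R) : R[i] :=
  (cexp m x0 + robin_coef m sigma * cexp (- m) x0) / (2 * m).
Definition green m (sigma x0 : R) : R -> R[i] :=
  glue m x0 (green_al m x0) (green_be m sigma x0) (green_ga m sigma x0).

Lemma green_continuous m (sigma x0 : R) :
  hypexp m (green_al m x0) (green_be m sigma x0) x0
  = hypexp m 0 (green_ga m sigma x0) x0.
Proof. by rewrite /hypexp /green_al /green_be /green_ga; ring. Qed.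

Lemma Re_gt0_neq0 m : 0 < complex.Re m -> m != 0.
Proof.
by move=> m0; apply/eqP => /(congr1 (@complex.Re R))/= /eqP; rewrite gt_eqF.
Qed.

(** The denominator 2 m normalises the jump, taken as left minus right, so that testing against the
    Green function returns exactly psi(x0). *)
Lemma green_jump m (sigma x0 : R) : 0 < complex.Re m ->
  hypexp m (m * green_al m x0) (- m * green_be m sigma x0) x0
  - hypexp m 0 (- m * green_ga m sigma x0) x0 = 1.
Proof.
move=> /Re_gt0_neq0 m0; rewrite /hypexp /green_al /green_be /green_ga.
transitivity (cexp m x0 * cexp (- m) x0); last exact: cexpNK.
by field; rewrite m0.
Qed.

(** It makes the boundary term at 0 from integration by parts cancel against the sigma term of the
    form. *)
Lemma green_robin m (sigma x0 : R) : 0 < complex.Re m -> 0 <= sigma ->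
  hypexp m (m * green_al m x0) (- m * green_be m sigma x0) 0
  = sigma%:C * hypexp m (green_al m x0) (green_be m sigma x0) 0.
Proof.
move=> m0 s0; have ms := robin_denom_neq0 m0 s0.
rewrite /hypexp /green_al /green_be /robin_coef !cexp0.
by field; rewrite ms Re_gt0_neq0.
Qed.

Lemma cabs_green_le m (sigma x0 y : R) : 0 < complex.Re m -> 0 <= sigma ->
  0 <= x0 -> 0 <= y -> cabs (green m sigma x0 y) <= (cabs m)^-1.
Proof.
move=> m0 s0 x00 y0.
have r1 := cabs_robin_coef_le1 m0 s0.
have cm0 : 0 < cabs m by rewrite cabs_gt0 Re_gt0_neq0.
(* [w1] and [w2] stand for exp (- m |x0 - y|) and exp (- m (x0 + y)); the 2 in the denominator
   absorbs 1 + |r|. *)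
have bound w1 w2 : cabs w1 <= 1 -> cabs w2 <= 1 ->
    cabs ((2 * m)^-1 * (w1 + robin_coef m sigma * w2)) <= (cabs m)^-1.
  move=> h1 h2; rewrite cabsM cabsV cabsM.
  have -> : cabs (2 : R[i]) = 2.
    by rewrite (_ : 2 = (2 : R)%:C) ?cabsR ?ger0_norm// rmorphD.
  rewrite invfM mulrC mulrA ler_piMl ?invr_ge0 ?cabs_ge0//.
  rewrite ler_pdivrMr// mul1r; apply: le_trans (cabsD _ _) _.
  rewrite cabsM (_ : 2 = 1 + 1) //; apply: lerD => //.
  by rewrite mulr_ile1 ?cabs_ge0.
have e1 z w (a b : R) : complex.Re z * a + complex.Re w * b <= 0 ->
    cabs (cexp z a * cexp w b) <= 1.
  by move=> h; rewrite cabsM !cabs_cexp -expRD -expR0 ler_expR.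
rewrite /green /glue; case: ifPn => yx0.
  rewrite (_ : hypexp _ _ _ _ = (2 * m)^-1 * (cexp (- m) x0 * cexp m y
      + robin_coef m sigma * (cexp (- m) x0 * cexp (- m) y))).
    by apply: bound; apply: e1; rewrite ?Re_opp; nra.
  by rewrite /hypexp /green_al /green_be; ring.
rewrite -ltNge in yx0.
rewrite (_ : hypexp _ _ _ _ = (2 * m)^-1 * (cexp m x0 * cexp (- m) y
    + robin_coef m sigma * (cexp (- m) x0 * cexp (- m) y))).
  by apply: bound; apply: e1; rewrite ?Re_opp; nra.
by rewrite /hypexp /green_ga; ring.
Qed.

Lemma eigenfunction_green (sigma : R) (V : cmeasure R) (lambda m : R[i])
    (u : R -> R[i]) psi (x0 : R) :
  0 <= sigma -> 0 < complex.Re m -> m ^+ 2 = - lambda ->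
  in_L2 u -> eq_L2 u psi ->
  (forall phi, schrodinger_form sigma V psi phi = inner (fun x => lambda * u x) phi) ->
  0 <= x0 ->
  psi x0 = cmeas_int V (halfline R) (fun x => psi x * green m sigma x0 x).
Proof.
move=> s0 m0 m2 uL2 upsi eqn x00.
have mH : measurable (halfline R) by exact: measurable_itv.
pose phi := H1_conj (H1_glue m0 x00 (green_continuous m sigma x0)).
have phiE x : conjc (phi x) = green m sigma x0 x by rewrite /phi /= conjcK.
have dphiE x : conjc (H1_der phi x) =
    glue m x0 (m * green_al m x0) (- m * green_be m sigma x0)
      (- m * green_ga m sigma x0) x.
  by rewrite /phi /= conjcK.
have := eqn phi; rewrite /schrodinger_form /inner.
under eq_cint do rewrite dphiE.
under [X in cmeas_int V _ X]eq_fun do rewrite phiE.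
have green0 : green m sigma x0 0
    = hypexp m (green_al m x0) (green_be m sigma x0) 0 by rewrite /green /glue x00.
rewrite phiE green0.
have gL2 : csq_integrable (halfline R) (green m sigma x0) by exact: csq_integrable_glue.
have ug : cintegrable (halfline R) (fun x => u x * green m sigma x0 x).
  by apply: csq_integrableM => //; exact: in_L2_csq_integrable.
have pg : cintegrable (halfline R) (fun x => psi x * green m sigma x0 x).
  by apply: csq_integrableM => //; exact: H1_val_csq.
(* On the side of the eigenvalue, u sits under a Lebesgue integral and may be replaced by its
   continuous representative psi. *)
have -> : cint (halfline R) (fun x => lambda * u x * conjc (phi x))
    = lambda * cint (halfline R) (fun x => psi x * green m sigma x0 x).
  rewrite -(eq_L2_cint ug pg); last first.
    by apply: ae_imp upsi => x /= h Hx; rewrite h.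
  by rewrite -cintZ//; apply: eq_cint => x _; rewrite phiE mulrA.
have := H1_weak_glue psi (green_al m x0) (green_be m sigma x0)
  (green_ga m sigma x0) m0 x00.
rewrite green_jump// green_robin// mulr1 m2 -/(green m sigma x0).
set I1 := cint _ _; set I2 := cint _ _; set W := cmeas_int _ _ _; set h := hypexp _ _ _ _.
move=> e1 e2; have -> : psi x0 = (psi x0 - psi 0 * (sigma%:C * h)) + psi 0 * (sigma%:C * h).
  by rewrite subrK.
rewrite -e1 -[W](subKr (I1 + sigma%:C * (psi 0 * h))) e2; ring.
Qed.

(** One of the two square roots of - lambda has positive real part, unless both are purely
    imaginary; then lambda would be the square of a real number. *)
Lemma off_halfline_sqrt (lambda : R[i]) : off_halfline lambda ->
  exists2 m : R[i], 0 < complex.Re m & m ^+ 2 = - lambda.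
Proof.
move=> hl; have s2 := sqr_sqrtc (- lambda); set s := sqrtc _ in s2.
case: (ltrgtP (complex.Re s) 0) => s0.
- by exists (- s); rewrite ?sqrrN// Re_opp oppr_gt0.
- by exists s.
- exfalso; apply: (hl (complex.Im s ^+ 2)); first exact: sqr_ge0.
  rewrite -[lambda]opprK -s2 expr2; apply: complex_ext; rewrite !ReImE s0 /=; ring.
Qed.

Lemma cabs_sqrt (lambda m : R[i]) : m ^+ 2 = - lambda ->
  Num.sqrt (cabs lambda) = cabs m.
Proof.
move=> m2; rewrite -cabsN -m2 expr2 cabsM -expr2 sqrtr_sqr ger0_norm//.
exact: cabs_ge0.
Qed.

(** A real upper bound v for the variation keeps the final cancellation of [sup S] inside the real
    numbers; a variation equal to +oo is trivial and is treated separately. *)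
Lemma eigenvalue_bound (sigma : R) (V : cmeasure R) (lambda : R[i]) (v : R) :
  0 <= sigma -> off_halfline lambda ->
  op_eigenvalue (schrodinger_operator sigma V) lambda ->
  (cmeas_variation V (halfline R) <= v%:E)%E ->
  Num.sqrt (cabs lambda) <= v.
Proof.
move=> s0 hl [u [u0 [uL2 _ [psi [upsi eqn]]]]] Vv.
have [m m0 m2] := off_halfline_sqrt hl.
rewrite (cabs_sqrt m2).
have cm0 : 0 < cabs m by rewrite cabs_gt0 Re_gt0_neq0.
have [M0 psiM0] := H1_bounded psi.
have HP (x : R) : halfline R x -> 0 <= x by rewrite /halfline/= in_itv/= andbT.
pose S := [set cabs (psi x) | x in halfline R].
have Sub x : 0 <= x -> cabs (psi x) <= sup S.
  move=> x0; apply: ub_le_sup; first by exists M0 => _ [y /HP y0 <-]; exact: psiM0.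
  by exists x => //; rewrite /halfline/= in_itv/= x0.
have S0 : S !=set0 by exists (cabs (psi 0)), 0 => //; rewrite /halfline/= in_itv/= lexx.
(* If psi vanished on the whole half-line, u would be a.e. zero and not an eigenfunction. *)
have [x [x0 psix]] : exists x, 0 <= x /\ psi x != 0.
  apply: contrapT => H; apply: u0; apply: ae_imp upsi => x /= h Hx.
  rewrite h//; apply/eqP; apply/negPn/negP => px; apply: H; exists x; split => //.
  exact: HP.
have supS0 : 0 < sup S by apply: lt_le_trans (Sub _ x0); rewrite cabs_gt0.
have : sup S <= sup S * (cabs m)^-1 * v.
  apply: ge_sup => // _ [y /HP y0 <-].
  rewrite (eigenfunction_green s0 m0 m2 uL2 upsi eqn y0).
  apply: cmeas_int_le => //.
    apply: cmeasurableM; first exact/csq_integrable_cmeasurable/H1_val_csq.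
    exact/csq_integrable_cmeasurable/csq_integrable_glue.
  move=> t t0; rewrite cabsM ler_pM ?cabs_ge0 ?Sub//.
  exact: cabs_green_le.
by rewrite -mulrA -[leLHS]mulr1 ler_pM2l// mulrC ler_pdivlMr// mul1r.
Qed.

End Resolvent.

(** * Sharpness *)

Section PointMassEigenvalue.
Context {R : realType}.
Notation mu := (@lebesgue_measure R).

(** If - m^2 is real then Re m Im m = 0, so m is real and nonzero, and - m^2 is negative. *)
Lemma off_halfline_opp_sqr (m : R[i]) : 0 < complex.Re m -> off_halfline (- m ^+ 2).
Proof.
move=> m0 r r0 /(congr1 (@GRing.opp _)); rewrite opprK expr2.
case: m m0 => a b /= a0 /eqP; rewrite eq_complex /= => /andP[/eqP re /eqP im].
have b0 : b = 0.
  have /eqP : a * b = 0 by lra.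
  by rewrite mulf_eq0 gt_eqF//= => /eqP.
by move: re; rewrite b0; nra.
Qed.

Lemma cmeas_variation_ge0 (V : cmeasure R) : (0 <= cmeas_variation V (halfline R))%E.
Proof.
apply: (@le_trans _ _ (\sum_(i < 1) cabs (cmeas V (halfline R)))%:E).
  by rewrite lee_fin sumr_ge0// => i _; exact: cabs_ge0.
apply: ereal_sup_ubound; exists 1%N, (fun=> halfline R); split => //.
- by move=> i; exact: measurable_itv.
- by move=> i j _ _ _; rewrite (ord1 i) (ord1 j).
- by apply/seteqP; split=> [x [i _ //]|x Hx]; exists ord0.
Qed.

(* A point mass m + sigma at the origin turns the boundary condition
   u'(0) = sigma u(0) into u'(0) = - m u(0), which exp (- m x) satisfies. *)
Lemma point_mass_eigenvalue (sigma : R) (m : R[i]) : 0 < complex.Re m ->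
  op_eigenvalue (schrodinger_operator sigma (point_mass (m + sigma%:C) 0))
    (- m ^+ 2).
Proof.
move=> m0; have mH : measurable (halfline R) by exact: measurable_itv.
have H0 : halfline R 0 by rewrite /halfline/= in_itv/= lexx.
have HP (x : R) : halfline R x -> 0 <= x by rewrite /halfline/= in_itv/= andbT.
have gl : hypexp m 0 1 0 = hypexp m 0 1 0 by [].
(* Gluing at 0 with the same coefficients on both sides presents exp (- m x) as a Sobolev
   function. *)
pose psi := H1_glue m0 (lexx 0) gl.
have psiE x : psi x = cexp (- m) x.
  by rewrite /psi /= /glue /hypexp; case: ifP => _; rewrite mul0r mul1r add0r.
have psiL2 : csq_integrable (halfline R) psi by exact: H1_val_csq.
exists psi; split.
  have cexp_neq0 x : cexp (- m) x != 0 by rewrite -cabs_eq0 cabs_cexp gt_eqF// expR_gt0.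
  move=> psi0; have neg : {ae mu, forall x, ~ halfline R x}.
    apply: ae_imp psi0 => x h Hx.
    by have /eqP := h Hx; rewrite psiE; apply/negP.
  have : mu (halfline R) = 0%E.
    apply: measure_negligible => //.
    by move: neg; apply: negligibleS => x /= Hx nHx.
  by rewrite /halfline lebesgue_measure_itv/= ltry.
split.
- exact: csq_integrable_in_L2.
- apply: csq_integrable_in_L2.
  have cst : csq_integrable (halfline R) (glue m 0 0 (- m ^+ 2) (- m ^+ 2)).
    exact: csq_integrable_glue.
  rewrite (_ : (fun x => _) = glue m 0 0 (- m ^+ 2) (- m ^+ 2))//.
  by apply/funext => x; rewrite psiE /glue /hypexp; case: ifP => _; ring.
- exists psi; split; first by apply: aeW.
  (* The roles are exchanged: the conjugate test function is the Sobolev function and the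
     eigenfunction is the glued one. Its derivative has no jump, so only the boundary term m chi(0)
     remains, which the point mass cancels together with the sigma term. *)
  move=> phi; pose chi := H1_conj phi.
  have [M1 psiM] := H1_bounded psi; have [M2 chiM] := H1_bounded chi.
  have := H1_weak_glue chi 0 1 1 m0 (lexx 0).
  rewrite /schrodinger_form /inner.
  rewrite (@cmeas_int_point_mass _ _ _ _ _ (M1 * M2))//; last 2 first.
  - by apply: cmeasurableM; [exact/csq_integrable_cmeasurable|
      exact/csq_integrable_cmeasurable/(H1_val_csq chi)].
  - move=> x /HP x0; rewrite cabsM ler_pM ?cabs_ge0 ?psiM//.
    exact: (chiM x x0).
  have -> : cint (halfline R) (fun x => H1_der psi x * conjc (H1_der phi x)) =
     cint (halfline R) (fun x => H1_der chi x * glue m 0 (m * 0) (- m * 1) (- m * 1) x).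
    by apply: eq_cint => x _; rewrite mulrC.
  have -> : cint (halfline R) (fun x => - m ^+ 2 * psi x * conjc (phi x)) =
     - m ^+ 2 * cint (halfline R) (fun x => chi x * glue m 0 0 1 1 x).
    rewrite -cintZ//; first by apply: eq_cint => x _; rewrite -mulrA [psi x * _]mulrC.
    by apply: csq_integrableM => //; exact: H1_val_csq.
  set I1 := cint _ _; set I2 := cint _ _ => e.
  have -> : I1 = I1 + m ^+ 2 * I2 - m ^+ 2 * I2 by rewrite addrK.
  rewrite e psiE -[conjc (phi 0)]/(chi 0) /hypexp !cexp0; ring.
Qed.

Lemma exists_eigenvalue_ratio (sigma theta kappa : R) : 0 <= sigma ->
  0 < theta -> theta < 2 * pi -> kappa < 1 ->
  exists (V : cmeasure R) (lambda : R[i]),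
    [/\ off_halfline lambda,
        lambda = (cabs lambda)%:C * cis theta,
        op_eigenvalue (schrodinger_operator sigma V) lambda &
        (kappa%:E * cmeas_variation V (halfline R)
           < (Num.sqrt (cabs lambda))%:E)%E].
Proof.
move=> s0 t0 t2 k1.
(* [t] will be |m|. The condition kappa (t + sigma) < t amounts to t (1 - kappa) > kappa sigma; the
   summand 1 makes this strict, and |kappa| keeps t positive when kappa is negative. *)
pose t := 1 + `|kappa| * sigma / (1 - kappa).
have k1' : 0 < 1 - kappa by rewrite subr_gt0.
have tgt0 : 0 < t.
  by rewrite ltr_pwDl// divr_ge0 ?(ltW k1')// mulr_ge0.
have tk : kappa * (t + sigma) < t.
  have : t * (1 - kappa) = (1 - kappa) + `|kappa| * sigma.
    by rewrite /t; field; rewrite gt_eqF.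
  have := ler_wpM2r s0 (ler_norm kappa); nra.
pose h := theta / 2.
have sh : 0 < sin h by apply: sin_gt0_pi; rewrite /h; apply/andP; split; lra.
(* This is - i t exp (i theta / 2), so - m^2 = t^2 exp (i theta); its real part is positive because
   theta / 2 lies strictly between 0 and pi. *)
pose m : R[i] := (t * sin h) +i* (- (t * cos h)).
have m0 : 0 < complex.Re m by rewrite /= mulr_gt0.
have cm : cabs m = t.
  rewrite cabsE /= sqrrN !exprMn -mulrDr addrC cos2Dsin2 mulr1 sqrtr_sqr.
  by rewrite ger0_norm// ltW.
have cl : cabs (- m ^+ 2) = t ^+ 2 by rewrite cabsN expr2 cabsM cm -expr2.
exists (point_mass (m + sigma%:C) 0), (- m ^+ 2); split.
- exact: off_halfline_opp_sqr.
- rewrite cl (_ : theta = h + h); last by rewrite /h; lra.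
  by apply: complex_ext; rewrite /cis cosD sinD expr2 !ReImE /=; ring.
- exact: point_mass_eigenvalue.
- rewrite (@cabs_sqrt _ _ m) ?opprK// cm.
  have Vle : (cmeas_variation (point_mass (m + sigma%:C)%R 0) (halfline R)
      <= (t + sigma)%R%:E)%E.
    apply: le_trans (cmeas_variation_point_mass _ _ _) _.
    by rewrite lee_fin; apply: le_trans (cabsD _ _) _; rewrite cm cabsR ger0_norm.
  have V0 := cmeas_variation_ge0 (point_mass (m + sigma%:C) 0).
  (* For negative kappa the upper bound on the variation would be reversed by the multiplication;
     instead the product is at most 0, below |m| = t. *)
  case: (leP 0 kappa) => k0.
    apply: (@le_lt_trans _ _ (kappa * (t + sigma))%:E); last by rewrite lte_fin.
    by rewrite EFinM; apply: lee_wpmul2l.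
  apply: (@le_lt_trans _ _ 0%E); last by rewrite lte_fin.
  by apply: mule_le0_ge0 => //; rewrite lee_fin ltW.
Qed.

End PointMassEigenvalue.

Theorem proposition1p5 (R : realType) (sigma : R) (sigma_ge0 : 0 <= sigma) :
  [/\ forall (V : cmeasure R) (lambda : R[i]),
        off_halfline lambda ->
        op_eigenvalue (schrodinger_operator sigma V) lambda ->
        ((Num.sqrt (cabs lambda))%:E <= cmeas_variation V (halfline R))%E,
      forall (V : R -> R[i]) (V_L1 : in_L1 V) (lambda : R[i]),
        off_halfline lambda ->
        op_eigenvalue (schrodinger_operator sigma (density_measure V_L1)) lambda ->
        ((Num.sqrt (cabs lambda))%:E <= L1norm V)%E &
      forall theta kappa : R, 0 < theta -> theta < 2 * pi -> kappa < 1 ->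
        exists (V : cmeasure R) (lambda : R[i]),
          [/\ off_halfline lambda,
              lambda = (cabs lambda)%:C * cis theta,
              op_eigenvalue (schrodinger_operator sigma V) lambda &
              (kappa%:E * cmeas_variation V (halfline R)
                 < (Num.sqrt (cabs lambda))%:E)%E]].
Proof.
have bound (V : cmeasure R) (lambda : R[i]) : off_halfline lambda ->
    op_eigenvalue (schrodinger_operator sigma V) lambda ->
    ((Num.sqrt (cabs lambda))%:E <= cmeas_variation V (halfline R))%E.
  move=> hl ev; have := cmeas_variation_ge0 V.
  case E : (cmeas_variation V (halfline R)) => [v| |]//= _; last by rewrite leey.
  by rewrite lee_fin; apply: (eigenvalue_bound sigma_ge0 hl ev); rewrite E.
split=> //.
- move=> V V_L1 lambda hl ev; apply: le_trans (bound _ _ hl ev) _.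
  exact: cmeas_variation_density.
- move=> theta kappa; exact: exists_eigenvalue_ratio.
Qed.
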